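(* Let $\sigma>0$, $R_0>0$, and constants $\rho_\ell,\rho_g>0$ be given, let $P_\ell(\cdot),P_g(\cdot)$ be smooth barotropic pressure laws, and suppose the equilibrium pressures $p_\ell=P_\ell(\rho_\ell)$, $p_g=P_g(\rho_g)$ satisfy $p_g-p_\ell=2\sigma/R_0$. Let $B^{(0)}$ be the open ball of radius $R_0$ centred at $0$, $\Omega_g^{(0)}=B^{(0)}$, $\Omega_\ell^{(0)}=\mathbb R^3\setminus\overline{B^{(0)}}$, $S^{(0)}=\partial B^{(0)}$, with unit normal $n(x)=x/R_0$ on $S^{(0)}$. Suppose that, for small $\varepsilon>0$, $(\varrho_\alpha,v_\alpha,P_\alpha)_{\alpha\in\{\ell,g\}}$ together with the interface $\Gamma(t)$ solve the nonlinear two-phase Euler free-boundary system with surface tension described in the context, and that they admit the expansions $$v_\alpha=\varepsilon u_\alpha+O(\varepsilon^2),\qquad \varrho_\alpha=\rho_\alpha+\varepsilon\rho_\alpha^{(1)}+O(\varepsilon^2),\qquad P_\alpha=p_\alpha+\varepsilon p_\alpha^{(1)}+O(\varepsilon^2),\qquad \alpha\in\{\ell,g\},$$ while $\Gamma(t)$ is parametrized by $$X(n,t)=\varepsilon\xi(t)+\bigl(R_0+\varepsilon h(n,t)\bigr)n,\qquad n\in\mathbb S^2,$$ with $\xi(t)\in\mathbb R^3$ and $h(\cdot,t)$ orthogonal in $L^2$ to the three degree-one spherical harmonics. Put $\eta(n,t):=\xi(t)\cdot n+h(n,t)$, regarded as a function on $S^{(0)}$ via $x=R_0n$. Then, at order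 $O(\varepsilon)$, the system reduces to the following equations on the equilibrium domains. (i) Bulk equations: with $K_\alpha:=\rho_\alpha P_\alpha'(\rho_\alpha)$, for $\alpha\in\{\ell,g\}$, $$\rho_\alpha\partial_tu_\alpha+\nabla p_\alpha^{(1)}=0,\qquad \frac1{K_\alpha}\partial_tp_\alpha^{(1)}+\nabla\cdot u_\alpha=0\qquad\text{in }\Omega_\alpha^{(0)},\ t>0.$$ (ii) Interface conditions on $S^{(0)}$, $t>0$: $$\partial_t\eta=u_\ell\cdot n=u_g\cdot n,\qquad p_\ell^{(1)}-p_g^{(1)}=\sigma\Bigl(\Delta_{S^{(0)}}+\frac2{R_0^2}\Bigr)\eta .$$
   Context: Nonlinear system: the gas bubble occupies $\mathcal B(t)\subset\mathbb R^3$, $\Gamma(t)=\partial\mathcal B(t)$, and the liquid occupies $\Omega_\ell(t)=\mathbb R^3\setminus\overline{\mathcal B(t)}$; $\nu(t)$ is the unit normal on $\Gamma(t)$ pointing from the gas into the liquid. In each phase ($\Omega_\ell(t)$ for $\alpha=\ell$, $\mathcal B(t)$ for $\alpha=g$) the density $\varrho_\alpha$, velocity $v_\alpha$ and pressure $P_\alpha$ satisfy $$\partial_t\varrho_\alpha+\nabla\cdot(\varrho_\alpha v_\alpha)=0,\qquad \varrho_\alpha(\partial_tv_\alpha+(v_\alpha\cdot\nabla)v_\alpha)+\nabla P_\alpha=0,\qquad P_\alpha=P_\alpha(\varrho_\alpha).$$ On $\Gamma(t)$: the kinematic condition $V_\Gamma=v_\ell\cdot\nu=v_g\cdot\nu$,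 where $V_\Gamma$ is the normal velocity of the interface in direction $\nu$, and the Young--Laplace condition $P_g-P_\ell=\sigma\kappa$, where $\kappa=\nabla_{\Gamma(t)}\cdot\nu$ (so $\kappa=2/R_0$ for a sphere of radius $R_0$). $\Delta_{S^{(0)}}$ is the Laplace--Beltrami operator on $S^{(0)}$. The expansions in $\varepsilon$ are understood for smooth fields (extended smoothly across the equilibrium interface where necessary) with remainders that may be differentiated in $x$ and $t$; ''at order $O(\varepsilon)$'' means that the coefficients of $\varepsilon$ in the equations and interface conditions, transported to the fixed reference geometry, are equated. *)

(* Defs.v *)
From HB Require Import structures.
From mathcomp Require Import all_boot all_order all_algebra.
From mathcomp Require Import all_classical all_reals all_analysis.
Set Implicit Arguments.
Unset Strict Implicit.
Unset Printing Implicit Defensive.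
Import Order.TTheory GRing.Theory Num.Theory.
Import numFieldNormedType.Exports.
Local Open Scope classical_set_scope.
Local Open Scope ring_scope.

(** Euclidean structure of R^3.  The norm [`|x|] of the library on ['rV[R]_3]
    is the sup norm, which gives the same topology; lengths and angles below
    are always taken with [dot] and [enorm]. *)

Definition dot (R : realType) (u v : 'rV[R]_3) : R := \sum_(i < 3) u 0 i * v 0 i.

Definition enorm (R : realType) (u : 'rV[R]_3) : R := Num.sqrt (dot u u).

Definition ebase (R : realType) (i : 'I_3) : 'rV[R]_3 := delta_mx 0 i.

Definition direction (R : realType) (x : 'rV[R]_3) : 'rV[R]_3 :=
  (enorm x)^-1 *: x.

Definition sphere (R : realType) (r : R) : set 'rV[R]_3 := [set x | enorm x = r].

Definition open_ball (R : realType) (r : R) : set 'rV[R]_3 :=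
  [set x | enorm x < r].

Definition frontier (T : topologicalType) (A : set T) : set T :=
  closure A `\` interior A.

Fixpoint iter_derive (R : realType) (V W : normedModType R)
    (vs : seq V) (f : V -> W) : V -> W :=
  if vs is v :: vs' then iter_derive vs' (fun x => 'D_v f x) else f.

Definition smooth_on (R : realType) (V W : normedModType R)
    (U : set V) (f : V -> W) : Prop :=
  forall (vs : seq V) (x : V), U x -> differentiable (iter_derive vs f) x.

(** Smooth up to the boundary of [A], a smooth extension being part of [f]. *)
Definition smooth_near (R : realType) (V W : normedModType R)
    (A : set V) (f : V -> W) : Prop :=
  exists U : set V, [/\ open U, A `<=` U & smooth_on U f].

Definition spacetime (R : realType) (V W : Type) (f : R -> V -> W) : R * V -> W :=
  fun z => f z.1 z.2.

Definition dt (R : realType) (V : Type) (W : normedModType R)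
    (f : R -> V -> W) (t : R) (x : V) : W := 'D_1 (fun s : R => f s x) t.

Definition grad (R : realType) (f : 'rV[R]_3 -> R) (x : 'rV[R]_3) : 'rV[R]_3 :=
  \row_(i < 3) 'D_(ebase R i) f x.

Definition divergence (R : realType) (F : 'rV[R]_3 -> 'rV[R]_3)
    (x : 'rV[R]_3) : R :=
  \sum_(i < 3) 'D_(ebase R i) (fun y => F y 0 i) x.

Definition advection (R : realType) (v : 'rV[R]_3 -> 'rV[R]_3)
    (x : 'rV[R]_3) : 'rV[R]_3 :=
  \sum_(i < 3) v x 0 i *: 'D_(ebase R i) v x.

(** Calculus on a hypersurface with unit normal [N].  [N], [f] and [F] are
    given on a neighbourhood of the surface; the values on the surface of
    [surf_grad], [surf_div] and [laplace_beltrami] depend only on the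
    restrictions of [N], [f] and [F] to the surface. *)

Definition surf_grad (R : realType) (N : 'rV[R]_3 -> 'rV[R]_3)
    (f : 'rV[R]_3 -> R) (x : 'rV[R]_3) : 'rV[R]_3 :=
  grad f x - dot (grad f x) (N x) *: N x.

Definition surf_div (R : realType) (N F : 'rV[R]_3 -> 'rV[R]_3)
    (x : 'rV[R]_3) : R :=
  \sum_(i < 3) surf_grad N (fun y => F y 0 i) x 0 i.

Definition laplace_beltrami (R : realType) (N : 'rV[R]_3 -> 'rV[R]_3)
    (f : 'rV[R]_3 -> R) (x : 'rV[R]_3) : R :=
  surf_div N (surf_grad N f) x.

(** A function on the unit sphere is represented by a function on R^3 of which
    only the values at unit vectors are used; [radial f] extends it to
    R^3 minus the origin as a function constant along rays. *)
Definition radial (R : realType) (W : Type) (f : 'rV[R]_3 -> W) : 'rV[R]_3 -> W :=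
  fun x => f (direction x).

Definition spherical_point (R : realType) (theta phi : R) : 'rV[R]_3 :=
  \row_(i < 3) [:: sin theta * cos phi; sin theta * sin phi; cos theta]`_i.

Definition sphere_integral (R : realType) (f : 'rV[R]_3 -> R) : R :=
  (\int[lebesgue_measure]_(phi in `[0%R, (2 * pi)%R])
     \int[lebesgue_measure]_(theta in `[0%R, pi])
       (f (spherical_point theta phi) * sin theta))%R.

(** The degree-one spherical harmonics are spanned by the three coordinate
    functions. *)
Definition orthogonal_to_degree_one (R : realType) (f : 'rV[R]_3 -> R) : Prop :=
  forall i : 'I_3, sphere_integral (fun n => f n * n 0 i) = 0.

Inductive phase := liquid | gas.

Definition region (R : realType) (B : set 'rV[R]_3) (a : phase) : set 'rV[R]_3 :=
  match a with liquid => ~` closure B | gas => B end.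

Definition closed_region (R : realType) (B : R -> set 'rV[R]_3) (a : phase) :
    set (R * 'rV[R]_3) :=
  [set z | 0 < z.1 /\ closure (region (B z.1) a) z.2].

Definition euler_in_phase (R : realType) (Plaw : R -> R)
    (Omega : R -> set 'rV[R]_3)
    (rho : R -> 'rV[R]_3 -> R) (v : R -> 'rV[R]_3 -> 'rV[R]_3)
    (P : R -> 'rV[R]_3 -> R) : Prop :=
  forall (t : R) x, 0 < t -> Omega t x ->
    [/\ dt rho t x + divergence (fun y => rho t y *: v t y) x = 0,
        rho t x *: (dt v t x + advection (v t) x) + grad (P t) x = 0
      & P t x = Plaw (rho t x)].

(** [nu] is smooth near the surface [X(sphere 1)] and is there the unit normal
    pointing out of [B].  Since [radial X] is constant along rays, its
    derivatives at a unit vector [n] are exactly the tangent vectors at [X n]. *)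
Definition is_outer_unit_normal (R : realType) (B : set 'rV[R]_3)
    (X nu : 'rV[R]_3 -> 'rV[R]_3) : Prop :=
  smooth_near (X @` sphere 1) nu /\
  forall n, sphere 1 n ->
    [/\ enorm (nu (X n)) = 1,
        forall w, dot (nu (X n)) ('D_w (radial X) n) = 0
      & \forall s \near 0^'+,
          region B liquid (X n + s *: nu (X n)) /\
          region B gas (X n - s *: nu (X n))].

(** The interface at time [t] is the frontier of [B t], parametrized by
    [X t] on the unit sphere; [dot (dt X t n) (nu t (X t n))] is its normal
    velocity and [surf_div (nu t) (nu t)] its curvature (sum of the principal
    curvatures, 2/R0 for a sphere of radius R0). *)
Record two_phase_euler (R : realType) (sigma : R) (Plaw : phase -> R -> R)
    (B : R -> set 'rV[R]_3) (X nu : R -> 'rV[R]_3 -> 'rV[R]_3)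
    (rho : phase -> R -> 'rV[R]_3 -> R)
    (v : phase -> R -> 'rV[R]_3 -> 'rV[R]_3)
    (P : phase -> R -> 'rV[R]_3 -> R) : Prop := TwoPhaseEuler {
  bubble_open : forall t : R, 0 < t -> open (B t);
  bubble_bounded : forall t : R, 0 < t -> bounded_set (B t);
  bubble_frontier : forall t : R, 0 < t -> frontier (B t) = X t @` sphere 1;
  nu_normal : forall t : R, 0 < t -> is_outer_unit_normal (B t) (X t) (nu t);
  fields_smooth : forall a,
    [/\ smooth_near (closed_region B a) (spacetime (rho a)),
        smooth_near (closed_region B a) (spacetime (v a))
      & smooth_near (closed_region B a) (spacetime (P a))];
  bulk : forall a,
    euler_in_phase (Plaw a) (fun t => region (B t) a) (rho a) (v a) (P a);
  kinematic : forall (t : R) n, 0 < t -> sphere 1 n ->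
    forall a, dot (dt X t n) (nu t (X t n)) =
              dot (v a t (X t n)) (nu t (X t n));
  young_laplace : forall (t : R) n, 0 < t -> sphere 1 n ->
    P gas t (X t n) - P liquid t (X t n) =
      sigma * surf_div (nu t) (nu t) (X t n)
}.

(** [f = f0 + e f1 + O(e^2)] as e -> 0+ on the open space-time set [D], for
    smooth fields; the remainder is O(e^2) locally uniformly, together with
    each of its derivatives in (t, x). *)
Definition expansion (R : realType) (W : normedModType R)
    (D : set (R * 'rV[R]_3)) (f : R -> R -> 'rV[R]_3 -> W)
    (f0 : W) (f1 : R -> 'rV[R]_3 -> W) : Prop :=
  [/\ smooth_on D (spacetime f1),
      \forall e \near 0^'+, smooth_on D (spacetime (f e))
    & forall (vs : seq (R * 'rV[R]_3)%type) z, D z -> exists C : R,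
        \forall e \near 0^'+ & y \near z,
          `|iter_derive vs
              (spacetime (fun t x => f e t x - (f0 + e *: f1 t x))) y|
            <= C * e ^+ 2].

(* Main.v *)
(** Dividing the bulk equations by [e] and letting [e -> 0+] gives the linear
    acoustic system, once each fixed point of the reference domain is known to
    lie in the right phase for small [e].  This holds because the interface is a
    radial graph of radius [R0 + e h] around [e xi], which splits space into the
    two sides of [|y - e xi| = R0 + e h].

    On the interface the outer unit normal is [G / |G|], where
    [G = grad (|y| - R0 - e g)], [y] is measured from [e xi] and [g] is [h]
    extended constantly along rays.  Since [grad g] is orthogonal to [y],
    [|G|^2 = 1 + e^2 |grad g|^2], so the normal tends to [n] and the curvature is
    [2 / |y| - e (Laplacian g) + O(e^2) = 2 / R0 - e (2 h / R0^2 + Laplacian g) + O(e^2)].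
    The translation [xi . n] does not contribute, being in the kernel of
    [Delta + 2 / R0^2], so [h] may be replaced by [eta]. *)

Require Import Defs.
From HB Require Import structures.
From mathcomp Require Import all_boot all_order all_algebra.
From mathcomp Require Import all_classical all_reals all_analysis.
From mathcomp Require Import ring lra.
Import Order.TTheory GRing.Theory Num.Theory.
Import numFieldNormedType.Exports.
Local Open Scope classical_set_scope.
Local Open Scope ring_scope.
Set Implicit Arguments.
Unset Strict Implicit.
Unset Printing Implicit Defensive.

(** * Euclidean geometry and calculus in R^3 *)

Section Euclid.
Context {R : realType}.
Implicit Types (u v w x y : 'rV[R]_3) (a c : R).

(** Three obstacles shape the argument. The bubble [B e t] is known only through its frontier, so
    which side of the surface is gas has to be derived, from connectedness along rays and
    boundedness. The normal [nu e t] is determined on the surface only, with an arbitrary smooth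
    extension around it, so its surface divergence may be computed from tangential derivatives
    alone; these are matched with derivatives of [direction \o G] by composing both with the radial
    retraction onto the surface. Finally, the expansions give bounds on remainders and no derivative
    in [e], so coefficients of [e] are equated as limits at [0^'+] of quotients by [e]. On the
    interface these quotients are taken at the moving point [X e t n], which uses the local
    uniformity of the remainders; likewise the second derivatives of [radial (h t)] must be
    continuous, since the curvature is evaluated at [(R0 + e * h t n) *: n]. *)

Lemma coordZ a u i : (a *: u) 0 i = a * u 0 i.
Proof. by rewrite mxE. Qed.

Lemma coordB u v i : (u - v) 0 i = u 0 i - v 0 i.
Proof. by rewrite mxE [X in _ + X]mxE. Qed.

Lemma ebase_diag i : ebase R i 0 i = 1.
Proof. by rewrite mxE !eqxx. Qed.

Lemma sum3E (V : nmodType) (F : 'I_3 -> V) :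
  \sum_(i < 3) F i = F 0 + F 1 + F 2%:R.
Proof.
rewrite !big_ord_recl big_ord0 addr0 addrA.
by congr (F _ + F _ + F _); apply/val_inj.
Qed.

Lemma dotE u v : dot u v = u 0 0 * v 0 0 + u 0 1 * v 0 1 + u 0 2%:R * v 0 2%:R.
Proof. by rewrite /dot sum3E. Qed.

Lemma dotC u v : dot u v = dot v u.
Proof. by rewrite !dotE; ring. Qed.

Lemma dotDl u v w : dot (u + v) w = dot u w + dot v w.
Proof. by rewrite !dotE !mxE; ring. Qed.

Lemma dotZl a u w : dot (a *: u) w = a * dot u w.
Proof. by rewrite !dotE !mxE; ring. Qed.

Lemma dotNl u w : dot (- u) w = - dot u w.
Proof. by rewrite !dotE !mxE; ring. Qed.

Lemma dotBl u v w : dot (u - v) w = dot u w - dot v w.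
Proof. by rewrite dotDl dotNl. Qed.

Lemma dotDr u v w : dot w (u + v) = dot w u + dot w v.
Proof. by rewrite dotC dotDl !(dotC w). Qed.

Lemma dotZr a u w : dot w (a *: u) = a * dot w u.
Proof. by rewrite dotC dotZl (dotC w). Qed.

Lemma dotNr u w : dot w (- u) = - dot w u.
Proof. by rewrite dotC dotNl (dotC w). Qed.

Lemma dotBr u v w : dot w (u - v) = dot w u - dot w v.
Proof. by rewrite dotDr dotNr. Qed.

Lemma dot0l u : dot 0 u = 0.
Proof. by rewrite -(scale0r 0) dotZl mul0r. Qed.

Lemma dot_ebaser u i : dot u (ebase R i) = u 0 i.
Proof.
rewrite /dot (bigD1 i)//= big1 ?addr0 ?mxE ?eqxx ?mulr1// => j ji.
by rewrite mxE eqxx (negbTE ji) mulr0.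
Qed.

Lemma dot_ge0 u : 0 <= dot u u.
Proof. by rewrite dotE -!expr2 !addr_ge0// sqr_ge0. Qed.

Lemma dot_eq0 u : (dot u u == 0) = (u == 0).
Proof.
apply/eqP/eqP => [u0|->]; last by rewrite dot0l.
apply/rowP => i; rewrite mxE.
have/psumr_eq0P := u0 => /(_ (fun i _ => sqr_ge0 (u 0 i)))/(_ i erefl)/eqP.
by rewrite mulf_eq0 orbb => /eqP.
Qed.

Lemma dot_inj u v : (forall w, dot u w = dot v w) -> u = v.
Proof. by move=> uv; apply/rowP => i; rewrite -!dot_ebaser uv. Qed.

Lemma enorm_ge0 u : 0 <= enorm u.
Proof. exact: sqrtr_ge0. Qed.

Lemma enorm2 u : enorm u ^+ 2 = dot u u.
Proof. by rewrite sqr_sqrtr// dot_ge0. Qed.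

Lemma enorm_eq0 u : (enorm u == 0) = (u == 0).
Proof. by rewrite -dot_eq0 -enorm2 expf_eq0. Qed.

Lemma enorm_gt0 u : (0 < enorm u) = (u != 0).
Proof. by rewrite lt_def enorm_ge0 enorm_eq0 andbT. Qed.

Lemma enormZ a u : enorm (a *: u) = `|a| * enorm u.
Proof.
by rewrite /enorm dotZl dotZr mulrA -expr2 sqrtrM ?sqr_ge0// sqrtr_sqr.
Qed.

Lemma sphere1_neq0 {u} : sphere 1 u -> u != 0.
Proof. by rewrite -enorm_gt0 => ->; rewrite ltr01. Qed.

Lemma sphere1_dot {u} : sphere 1 u -> dot u u = 1.
Proof. by rewrite -enorm2 => ->; rewrite expr1n. Qed.

Lemma sphere_direction {u} : u != 0 -> sphere 1 (direction u).
Proof.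
move=> u0; rewrite /sphere /= /direction enormZ ger0_norm ?invr_ge0 ?enorm_ge0//.
by rewrite mulVf// enorm_eq0.
Qed.

Lemma enorm_direction u : enorm u *: direction u = u.
Proof.
have [->|u0] := eqVneq u 0; first by rewrite /direction !scaler0.
by rewrite /direction scalerA divff ?scale1r// enorm_eq0.
Qed.

Lemma directionZ c u : 0 < c -> direction (c *: u) = direction u.
Proof.
move=> c0; rewrite /direction enormZ gtr0_norm// scalerA invfM mulrAC.
by rewrite mulVf ?mul1r ?gt_eqF.
Qed.

Lemma direction_sphere {u} : sphere 1 u -> direction u = u.
Proof. by rewrite /direction => ->; rewrite invr1 scale1r. Qed.

End Euclid.

Section Calculus.
Context {R : realType}.

Section Normed.
Context {V W : normedModType R}.

Lemma derive_comp (U : normedModType R) (f : U -> V) (g : V -> W) x w :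
  differentiable f x -> differentiable g (f x) ->
  'D_w (g \o f) x = 'D_('D_w f x) g (f x).
Proof.
move=> df dg; rewrite (deriveE _ dg) (deriveE _ df).
by rewrite (deriveE _ (differentiable_comp df dg)) diff_comp.
Qed.

(* No differentiability is needed: both difference quotients coincide. *)
Lemma derive_homog (f : V -> W) c x w : (forall y, f (c *: y) = f y) ->
  'D_(c *: w) f (c *: x) = 'D_w f x.
Proof.
move=> fc; rewrite /derive; set k := (X in X @ _); set l := (X in _ = lim (X @ _)).
suff -> : k = l by []; apply/funext => s; rewrite /k /l /=.
by rewrite scalerA mulrC -scalerA -scalerDr !fc.
Qed.

(** For [|s| < 1] the point [s *: x + x] is the positive multiple [(1 + s) *: x], so the difference
    quotient is eventually zero. *)
Lemma derive_homog_self (f : V -> W) x : (forall c y, 0 < c -> f (c *: y) = f y) ->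
  'D_x f x = 0.
Proof.
move=> fc; apply/lim_near_cst => //; near=> s.
rewrite /= -{2}(scale1r x) -scalerDl fc ?subrr ?scaler0//.
have : `|s| < 1 by near: s; apply: dnbhs0_lt.
by rewrite ltr_norml => /andP[s1 _]; rewrite -ltrBlDr sub0r.
Unshelve. all: by end_near. Qed.

(** Smoothness and expansions are stated with space-time derivatives, the equations with slices. The
    directions [(0, w)] and, below, [(1, 0)] translate between the two. *)
Lemma derive_slice (f : R -> V -> W) t x w :
  'D_w (f t) x = 'D_(0, w) (spacetime f) (t, x).
Proof.
rewrite /derive; set k := (X in X @ _); set l := (X in _ = lim (X @ _)).
suff -> : k = l by []; apply/funext => s; rewrite /k /l /=.
by rewrite /spacetime /= scaler0 add0r.
Qed.

Lemma differentiable_slice (f : R -> V -> W) t x :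
  differentiable (spacetime f) (t, x) -> differentiable (f t) x.
Proof.
move=> df; have -> : f t = spacetime f \o (fun y => (t, y)) by [].
by apply: differentiable_comp df; exact: (@differentiable_pair _ _ _ _ (cst t) id).
Qed.

Lemma dt_slice (f : R -> V -> W) t x :
  dt f t x = 'D_(1, 0) (spacetime f) (t, x).
Proof.
rewrite /dt /derive; set k := (X in X @ _); set l := (X in _ = lim (X @ _)).
suff -> : k = l by []; apply/funext => s; rewrite /k /l /=.
by rewrite /spacetime /= scaler0 add0r.
Qed.

Lemma derivable_dt_slice (f : R -> V -> W) t x :
  differentiable (spacetime f) (t, x) -> derivable (fun s => f s x) t 1.
Proof.
move=> df; apply: diff_derivable.
have -> : f^~ x = spacetime f \o (fun s => (s, x)) by [].
by apply: differentiable_comp df; exact: (@differentiable_pair _ _ _ _ id (cst x)).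
Qed.

End Normed.

Section Row.
Context {V : normedModType R}.

Lemma row_sum_ebase (u : 'rV[R]_3) : u = \sum_(i < 3) u 0 i *: ebase R i.
Proof. exact: row_sum_delta. Qed.

Lemma differentiable_rV (F : V -> 'rV[R]_3) x :
  (forall i, differentiable (fun y => F y 0 i) x) -> differentiable F x.
Proof.
move=> dF; rewrite (_ : F = \sum_(i < 3) (fun y => F y 0 i *: ebase R i)).
  by apply: differentiable_sum => i; exact: differentiableZl.
by apply/funext => y; rewrite fct_sumE [LHS]row_sum_ebase.
Qed.

Lemma differentiable_coordE (F : V -> 'rV[R]_3) x i :
  differentiable F x -> differentiable (fun y => F y 0 i) x.
Proof.
move=> dF.
apply: (@differentiable_comp _ _ _ _ F (fun u : 'rV[R]_3 => u 0 i)) => //.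
exact: differentiable_coord.
Qed.

Lemma derive_coord (F : V -> 'rV[R]_3) x w i :
  derivable F x w -> 'D_w (fun y => F y 0 i) x = 'D_w F x 0 i.
Proof. by move=> dF; rewrite (derive_mx dF) mxE. Qed.

Lemma differentiable_dot (F G : V -> 'rV[R]_3) x :
  differentiable F x -> differentiable G x ->
  differentiable (fun y => dot (F y) (G y)) x.
Proof.
move=> dF dG; rewrite (_ : (fun y => _) =
  \sum_(i < 3) ((fun y => F y 0 i) * (fun y => G y 0 i))).
  by apply: differentiable_sum => i; apply: differentiableM;
     exact: differentiable_coordE.
by apply/funext => y; rewrite fct_sumE.
Qed.

Lemma derive_dot (F G : V -> 'rV[R]_3) x w :
  derivable F x w -> derivable G x w ->
  'D_w (fun y => dot (F y) (G y)) x = dot ('D_w F x) (G x) + dot (F x) ('D_w G x).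
Proof.
move=> dF dG; have /derivable_mxP dF' := dF; have /derivable_mxP dG' := dG.
rewrite (_ : (fun y => _) =
  \sum_(i < 3) ((fun y => F y 0 i) * (fun y => G y 0 i))); last first.
  by apply/funext => y; rewrite fct_sumE.
rewrite derive_sum => [|i]; last by apply: derivableM.
rewrite /dot -big_split; apply: eq_bigr => i _ /=.
rewrite deriveM; [|exact: dF'|exact: dG'].
rewrite (derive_coord _ dF) (derive_coord _ dG) addrC; congr (_ + _).
by rewrite mulrC.
Qed.

Lemma derive_dot_self (F : V -> 'rV[R]_3) x w :
  derivable F x w -> 'D_w (fun y => dot (F y) (F y)) x = 2 * dot (F x) ('D_w F x).
Proof. by move=> dF; rewrite derive_dot// dotC mulr2n mulrDl mul1r. Qed.

End Row.

Lemma derive_grad (f : 'rV[R]_3 -> R) x w :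
  differentiable f x -> 'D_w f x = dot (grad f x) w.
Proof.
move=> df; rewrite deriveE// {1}(row_sum_ebase w) linear_sum /dot.
by apply: eq_bigr => i _; rewrite linearZ mxE deriveE// mulrC.
Qed.

Lemma derive_sumE (W : normedModType R) (f : 'rV[R]_3 -> W) x w :
  differentiable f x -> 'D_w f x = \sum_(i < 3) w 0 i *: 'D_(ebase R i) f x.
Proof.
move=> df; rewrite deriveE// {1}(row_sum_ebase w) linear_sum.
by apply: eq_bigr => i _; rewrite linearZ deriveE.
Qed.

Lemma differentiable_enorm (x : 'rV[R]_3) : x != 0 -> differentiable (@enorm R) x.
Proof.
move=> x0; apply: (@differentiable_comp _ _ _ _ (fun y => dot y y) Num.sqrt).
  exact: differentiable_dot.
apply/derivable1_diffP; apply: ex_derive.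
by apply: is_derive1_sqrt; rewrite lt_def dot_eq0 x0 dot_ge0.
Qed.

Lemma derive_enorm (x w : 'rV[R]_3) : x != 0 ->
  'D_w (@enorm R) x = dot (direction x) w.
Proof.
move=> x0; have dn : derivable (@enorm R) x w.
  exact/diff_derivable/differentiable_enorm.
have e0 : enorm x != 0 by rewrite enorm_eq0.
(* Differentiating the square of the length and cancelling [enorm x] yields the derivative of the
   length itself. *)
have E : 'D_w (fun y => enorm y * enorm y) x = 'D_w (fun y => dot y y) x.
  by congr ('D_w _ x); apply/funext => y; rewrite -expr2 enorm2.
move: E; rewrite deriveM// derive_dot_self// derive_id => E.
apply: (mulfI e0); rewrite /direction dotZl mulrA divff// mul1r.
by move: E; rewrite /GRing.scale /=; lra.
Qed.

Lemma differentiable_enormV (x : 'rV[R]_3) : x != 0 ->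
  differentiable (fun y => (@enorm R y)^-1) x.
Proof.
move=> x0; apply: differentiableV; first exact: differentiable_enorm.
by rewrite enorm_eq0.
Qed.

Lemma derive_enormV (x w : 'rV[R]_3) : x != 0 ->
  'D_w (fun y => (@enorm R y)^-1) x = - (enorm x)^-1 ^+ 3 * dot x w.
Proof.
move=> x0; have e0 : enorm x != 0 by rewrite enorm_eq0.
rewrite deriveV//; last exact/diff_derivable/differentiable_enorm.
rewrite derive_enorm// /direction dotZl /GRing.scale /=.
by field.
Qed.

Lemma differentiable_direction (x : 'rV[R]_3) : x != 0 ->
  differentiable (@direction R) x.
Proof.
move=> x0; apply: differentiable_rV => i.
rewrite (_ : (fun y => _) =
  (fun y => (@enorm R y)^-1) * (fun y : 'rV[R]_3 => y 0 i)).
  apply: differentiableM; first exact: differentiable_enormV.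
  exact: differentiable_coord.
by apply/funext => y; rewrite !mxE.
Qed.

Lemma derive_direction (x w : 'rV[R]_3) : x != 0 ->
  'D_w (@direction R) x =
    (enorm x)^-1 *: w - ((enorm x)^-1 ^+ 3 * dot x w) *: x.
Proof.
move=> x0; apply/rowP => i; rewrite -derive_coord; last first.
  exact/diff_derivable/differentiable_direction.
rewrite (_ : (fun y => _) =
  (fun y => (@enorm R y)^-1) * (fun y : 'rV[R]_3 => y 0 i)); last first.
  by apply/funext => y; rewrite !mxE.
rewrite deriveM; last 2 first.
- exact/diff_derivable/differentiable_enormV.
- exact/diff_derivable/differentiable_coord.
rewrite derive_enormV// derive_coord// derive_id !mxE /GRing.scale /=.
ring.
Qed.

End Calculus.

(** * Star-shaped bubbles *)

(** Off its frontier, [A] and [closure A] have the same trace on [C], which is therefore both open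
    and closed in [C]. *)
Lemma connected_sub_open (T : topologicalType) (A C : set T) :
  open A -> connected C -> (forall y, C y -> ~ frontier A y) ->
  C `&` A !=set0 -> C `<=` A.
Proof.
move=> oA cC CA CA0.
rewrite -(cC (C `&` A)) //; first by exists A.
exists (closure A); first exact: closed_closure.
apply/seteqP; split=> y [Cy Ay]; split=> //; first exact: subset_closure.
apply: contrapT => nAy; apply: (CA _ Cy); split => //.
by move=> /interior_subset.
Qed.

(* Along each ray from [c] the frontier is met exactly once, so by
   connectedness membership in [B] can only change there. *)
Section StarShapedBubble.
Context {R : realType} (B : set 'rV[R]_3) (c : 'rV[R]_3) (r : 'rV[R]_3 -> R).
Hypotheses (oB : open B) (bB : bounded_set B)
  (fB : frontier B = (fun n => c + r n *: n) @` sphere 1)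
  (r0 : forall n, sphere 1 n -> 0 < r n).

Lemma continuous_ray (n : 'rV[R]_3) : continuous (fun s : R => c + s *: n).
Proof.
move=> s; apply: cvgD; first exact: cvg_cst.
by apply: cvgZl; exact: cvg_id.
Qed.

(** Comparing lengths in [s *: n = r m *: m] gives [s = r m]; as this is nonzero, [n = m]. *)
Lemma frontier_ray n s : sphere 1 n -> 0 <= s -> frontier B (c + s *: n) -> s = r n.
Proof.
move=> n1 s0; rewrite fB => -[m m1 /addrI E].
have Es : s = r m.
  move: (congr1 (@enorm R) E); rewrite !enormZ n1 m1 !mulr1.
  by rewrite ger0_norm ?ltW ?r0// ger0_norm// => ->.
have s_neq0 : s != 0 by rewrite Es gt_eqF ?r0.
by rewrite Es; congr r; apply: (scalerI s_neq0); rewrite -E Es.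
Qed.

Lemma segment_in_bubble n s1 s2 s : sphere 1 n -> 0 <= s1 ->
  (forall t, s1 <= t <= s2 -> t != r n) ->
  s1 <= s <= s2 -> B (c + s *: n) -> forall t, s1 <= t <= s2 -> B (c + t *: n).
Proof.
move=> n1 s10 nr ss Bs t tt.
set ray := fun s : R => c + s *: n.
have cC : connected (ray @` `[s1, s2]).
  apply: connected_continuous_connected; first exact: segment_connected.
  exact/continuous_subspaceT/continuous_ray.
apply: (@connected_sub_open _ B (ray @` `[s1, s2])) => //.
- move=> _ [/= a] + <-; rewrite in_itv /= => aa /frontier_ray ar.
  move: (nr _ aa); rewrite ar ?eqxx//.
  by case/andP: aa => + _; exact: le_trans.
- by exists (c + s *: n); split => //; exists s => //=; rewrite in_itv.
- by exists t => //=; rewrite in_itv.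
Qed.

Lemma ray_outside_bubble n s : sphere 1 n -> r n < s -> ~ B (c + s *: n).
Proof.
move=> n1 rs Bs.
have n0 : 0 < `|n| by rewrite normr_gt0 sphere1_neq0.
have [M [_ BM]] := bB.
have {}BM := BM (M + 1) (ltr_pwDr ltr01 (lexx _)).
(* Far enough along the ray to contradict boundedness: the norm of [t *: n] is at least
   [|M + 1| + |c| + 1], so that of [c + t *: n] exceeds [M + 1]. The division is there because the
   bound is in the sup norm, in which [n] need not have norm one. *)
set t := s + (`|M + 1| + `|c| + 1) / `|n|.
have Ct : 0 <= (`|M + 1| + `|c| + 1) / `|n|.
  by rewrite divr_ge0// !addr_ge0.
have st : s <= t by rewrite lerDl.
have s0 : 0 <= s by rewrite ltW// (lt_trans _ rs)// r0.
have Bt : B (c + t *: n).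
  apply: (@segment_in_bubble n s t s) => //; rewrite ?lexx ?st//.
  by move=> a /andP[sa _]; rewrite gt_eqF// (lt_le_trans rs).
have := BM _ Bt; apply/negP; rewrite -ltNge.
have : `|t *: n| <= `|c + t *: n| + `|c|.
  by rewrite -[X in `|X| <= _](addKr c) addrC -(normrN c) ler_normD.
rewrite normrZ ger0_norm ?(le_trans s0)// /t mulrDl divfK ?gt_eqF// => H.
have := ler_norm (M + 1); have := mulr_ge0 s0 (ltW n0).
lra.
Qed.

Lemma ray_frontier_bubble n : sphere 1 n -> ~ B (c + r n *: n).
Proof.
move=> n1 Bn; have : frontier B (c + r n *: n) by rewrite fB; exists n.
by rewrite /frontier => -[_]; apply; apply: open_nbhs_nbhs; split.
Qed.

Lemma center_in_bubble : B c.
Proof.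
have [y By] : B !=set0.
  (* An empty bubble would have an empty frontier, whereas [fB] puts the image of a basis vector on
     it. *)
  apply/set0P/eqP => B0; move: fB; rewrite /frontier B0 closure0 set0D => fB0.
  have e1 : sphere 1 (ebase R 0).
    by rewrite /sphere /= /enorm dot_ebaser mxE !eqxx sqrtr1.
  have : set0 (c + r (ebase R 0) *: ebase R 0) by rewrite fB0; exists (ebase R 0).
  by [].
have [->//|yc] := eqVneq c y; move: yc By; rewrite eq_sym -subr_eq0.
set n := direction (y - c); move=> yc.
have n1 : sphere 1 n := sphere_direction yc.
have -> : y = c + enorm (y - c) *: n by rewrite enorm_direction subrKC.
move=> By; rewrite -[c]addr0 -(scale0r n).
apply: (@segment_in_bubble n 0 (enorm (y - c)) (enorm (y - c))) => //.
- move=> t /andP[_ ty]; apply/eqP => tr.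
  have := ray_outside_bubble n1; move=> /(_ (enorm (y - c))).
  move: ty; rewrite le_eqVlt => /predU1P[ty|]; last by rewrite tr => /[swap] /[apply].
  by move=> _; apply: (ray_frontier_bubble n1); rewrite -tr ty.
- by rewrite enorm_ge0 lexx.
- by rewrite lexx enorm_ge0.
Qed.

Lemma ray_inside_bubble n s : sphere 1 n -> 0 <= s < r n -> B (c + s *: n).
Proof.
move=> n1 /andP[s0 sr].
apply: (@segment_in_bubble n 0 s 0) => //; rewrite ?lexx ?s0//.
- by move=> t /andP[_ ts]; rewrite lt_eqF// (le_lt_trans ts).
- by rewrite scale0r addr0; exact: center_in_bubble.
Qed.

Lemma bubble_inside y : enorm (y - c) < r (direction (y - c)) -> B y.
Proof.
have [->|yc] := eqVneq y c; first by move=> _; exact: center_in_bubble.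
rewrite -subr_eq0 in yc => yr; rewrite -(subrKC c y) -(enorm_direction (y - c)).
by apply: ray_inside_bubble; [exact: sphere_direction|rewrite enorm_ge0].
Qed.

Lemma bubble_outside y : y != c ->
  r (direction (y - c)) < enorm (y - c) -> ~ closure B y.
Proof.
rewrite -subr_eq0 => yc yr; have n1 := sphere_direction yc.
have Ey : y = c + enorm (y - c) *: direction (y - c).
  by rewrite enorm_direction subrKC.
have nBy : ~ B y by rewrite Ey; exact: ray_outside_bubble.
move=> cBy; have : frontier B y by split=> // /interior_subset.
rewrite Ey => /(frontier_ray n1 (enorm_ge0 _)) E.
by move: yr; rewrite -E ltxx.
Qed.

End StarShapedBubble.

(** * Normal and curvature of a radial graph *)

Section RightDerivative.
Context {R : realType} {V : normedModType R}.

Lemma derive_cvg_at_right (W : normedModType R) (f : V -> W) x w : derivable f x w ->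
  (s^-1 *: (f (s *: w + x) - f x)) @[s --> 0^'+] --> 'D_w f x.
Proof.
by move=> df; exact: cvg_dnbhs_at_right df.
Qed.

Lemma derive_right_ge0 (f : V -> R) x w : derivable f x w ->
  (\forall s \near 0^'+, f x <= f (s *: w + x)) -> 0 <= 'D_w f x.
Proof.
move=> df fx.
apply: (cvgr_to_ge (derive_cvg_at_right df)); near=> s.
have s0 : 0 < s by near: s; exact: nbhs_right_gt.
have fs : f x <= f (s *: w + x) by near: s.
by apply: mulr_ge0; rewrite ?invr_ge0 ?subr_ge0// ltW.
Unshelve. all: by end_near. Qed.

End RightDerivative.

Section RadialGraph.
Context {R : realType} (c : 'rV[R]_3) (r : 'rV[R]_3 -> R).
Let X := fun n : 'rV[R]_3 => c + r n *: n.
Let f := radial r.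
Hypotheses (r0 : forall n, sphere 1 n -> 0 < r n)
  (df : forall y, y != 0 -> differentiable f y)
  (ddf : forall y, y != 0 -> differentiable (grad f) y).

Definition level_gradient (g : 'rV[R]_3 -> R) (y : 'rV[R]_3) : 'rV[R]_3 :=
  direction y - grad g y.
Let G := level_gradient f.

Lemma radialZ (W : Type) (g : 'rV[R]_3 -> W) a y : 0 < a ->
  radial g (a *: y) = radial g y.
Proof. by move=> a0; rewrite /radial directionZ. Qed.

Lemma derive_radial_self (g : 'rV[R]_3 -> R) y : 'D_y (radial g) y = 0.
Proof. by apply: derive_homog_self => a z a0; rewrite radialZ. Qed.

Lemma grad_radial_dot y : y != 0 -> dot (grad f y) y = 0.
Proof. by move=> y0; rewrite -derive_grad ?derive_radial_self//; exact: df. Qed.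

Lemma near_neq0 (y : 'rV[R]_3) : y != 0 -> \forall z \near y, z != 0.
Proof.
have yy : z @[z --> y] --> y by [].
by move=> y0; exact: (cvgr_neq0 _ yy y0).
Qed.

Lemma radial_scale_sphere n : sphere 1 n ->
  [/\ r n *: n != 0, enorm (r n *: n) = r n, direction (r n *: n) = n
    & f (r n *: n) = r n].
Proof.
move=> n1; have rn := r0 n1.
have dn : direction (r n *: n) = n by rewrite directionZ// direction_sphere.
split=> //; first by rewrite scaler_eq0 negb_or gt_eqF//= sphere1_neq0.
  by rewrite enormZ n1 mulr1 gtr0_norm.
by rewrite /f /radial dn.
Qed.

Lemma differentiable_radial_graph y : y != 0 -> differentiable (radial X) y.
Proof.
move=> y0; apply: differentiable_rV => i.
rewrite (_ : (fun y => _) = cst (c 0 i) + f * (fun y => @direction R y 0 i)).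
  apply: differentiableD => //; apply: differentiableM; first exact: df.
  exact/differentiable_coordE/differentiable_direction.
by apply/funext => z; rewrite /radial /X 2!mxE.
Qed.

(** [radial X] retracts space onto the surface along rays. Its differential is the projection along
    [n] onto the plane orthogonal to [G], a projection because [dot G n = 1]. The base point
    [r n *: n] is the surface point seen from [c]; there the factor [r n] cancels the inverse length
    in the derivative of [direction], so tangent vectors are fixed. *)
Lemma derive_radial_graph n w : sphere 1 n ->
  'D_w (radial X) (r n *: n) = w - dot (G (r n *: n)) w *: n.
Proof.
move=> n1; have [p0 pe pd pf] := radial_scale_sphere n1.
have rn : r n != 0 by rewrite gt_eqF ?r0.
apply/rowP => i; rewrite -derive_coord; last first.
  exact/diff_derivable/differentiable_radial_graph.
rewrite (_ : (fun y => _) = cst (c 0 i) + f * (fun y => @direction R y 0 i)); last first.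
  by apply/funext => z; rewrite /radial /X 2!mxE.
have dd : derivable (fun y => @direction R y 0 i) (r n *: n) w.
  exact/diff_derivable/differentiable_coordE/differentiable_direction.
have dff : derivable f (r n *: n) w by exact/diff_derivable/df.
have dfd := derivableM dff dd.
rewrite deriveD; [|exact: derivable_cst|exact: dfd].
rewrite derive_cst add0r (deriveM dff dd) derive_coord; last first.
  exact/diff_derivable/differentiable_direction.
rewrite derive_direction// pf pd pe (derive_grad w (df p0)) /GRing.scale /=.
rewrite /G /level_gradient pd dotBl dotZl !mxE.
by field.
Qed.

Lemma dot_level_gradient n : sphere 1 n -> dot (G (r n *: n)) n = 1.
Proof.
move=> n1; have [p0 pe pd pf] := radial_scale_sphere n1.
have rn : r n != 0 by rewrite gt_eqF ?r0.
have := grad_radial_dot p0; rewrite dotZr => /eqP.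
rewrite mulf_eq0 (negbTE rn)/= => /eqP E.
by rewrite /G /level_gradient dotBl pd E subr0 sphere1_dot.
Qed.

Lemma level_gradient_neq0 n : sphere 1 n -> G (r n *: n) != 0.
Proof.
move=> /dot_level_gradient n1; apply/eqP => G0.
by move: n1; rewrite G0 dot0l => /esym/eqP; rewrite oner_eq0.
Qed.

Lemma dot_level_gradient_self y : y != 0 ->
  dot (G y) (G y) = 1 + dot (grad f y) (grad f y).
Proof.
move=> y0; rewrite /G /level_gradient dotBl !dotBr.
rewrite (sphere1_dot (sphere_direction y0)) (dotC (direction y)).
by rewrite /direction dotZr grad_radial_dot// mulr0 subr0 sub0r opprK.
Qed.

Lemma differentiable_level_gradient y : y != 0 -> differentiable G y.
Proof.
move=> y0; apply: (@differentiableB _ _ _ (@direction R) (grad f)).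
  exact: differentiable_direction.
exact: ddf.
Qed.

(** Half the derivative of the identity for [dot (G y) (G y)]. It replaces [G] by [grad f], which is
    of first order in [e] for the perturbed sphere, and so makes this term quadratic. *)
Lemma dot_derive_level_gradient y w : y != 0 ->
  dot (G y) ('D_w G y) = dot (grad f y) ('D_w (grad f) y).
Proof.
move=> y0; apply: (@mulfI _ 2); first by rewrite pnatr_eq0.
have dG := differentiable_level_gradient y0; have dg := ddf y0.
rewrite -!derive_dot_self; [|exact/diff_derivable..].
have -> : 'D_w (fun z => dot (G z) (G z)) y =
    'D_w (cst 1 + (fun z => dot (grad f z) (grad f z))) y.
  apply: near_eq_derive; near=> z; rewrite dot_level_gradient_self//.
  by near: z; exact: near_neq0.
have dgg := differentiable_dot dg dg.
rewrite deriveD; [|exact: derivable_cst|exact: diff_derivable].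
by rewrite derive_cst add0r.
Unshelve. all: by end_near. Qed.

Variables (B : set 'rV[R]_3) (nu : 'rV[R]_3 -> 'rV[R]_3).
Hypotheses (oB : open B) (bB : bounded_set B) (fB : frontier B = X @` sphere 1)
  (nuP : is_outer_unit_normal B X nu).

(* Tangency forces [nu] to be a multiple of [G], the gradient of
   [y |-> enorm (y - c) - radial r (y - c)]; the sign comes from the fact that
   this function is nonnegative outside the bubble. *)
Lemma outer_unit_normalE n : sphere 1 n -> nu (X n) = direction (G (r n *: n)).
Proof.
move=> n1; have [p0 pe pd pf] := radial_scale_sphere n1.
have [_ /(_ n n1)[m1 mT mO]] := nuP; set m := nu (X n) in m1 mT mO *.
set p := r n *: n in p0 pe pd pf *.
have rn : r n != 0 by rewrite gt_eqF ?r0.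
have mG : m = dot m n *: G p.
  apply: dot_inj => w; rewrite dotZl.
  (* Tangency is assumed at [n], while the retraction was differentiated at [r n *: n]; homogeneity
     moves the base point and rescales the direction by [r n]. *)
  have := mT ((r n)^-1 *: w).
  rewrite -(@derive_homog _ _ _ _ (r n)); last first.
    by move=> y; rewrite radialZ// r0.
  rewrite scalerA divff// scale1r derive_radial_graph// dotBr dotZr.
  by move=> /eqP; rewrite subr_eq0 => /eqP ->; rewrite mulrC.
have F0 : 0 <= 'D_m ((@enorm R) - f) p.
  apply: derive_right_ge0.
    apply: derivableB; apply: diff_derivable; last exact: df.
    exact: differentiable_enorm.
  near=> s.
  have [sO _] : region B liquid (X n + s *: m) /\ region B gas (X n - s *: m).
    by near: s.
  have Fz z : ((@enorm R) - f) z = enorm z - f z by [].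
  rewrite !Fz pe pf subrr subr_ge0 leNgt.
  apply/negP => lt; apply: sO; apply: subset_closure.
  apply: (bubble_inside oB bB fB r0).
  have -> : X n + s *: m - c = s *: m + p.
    by rewrite /X addrAC (addrAC c) subrr add0r addrC.
  exact: lt.
have DE : 'D_m ((@enorm R) - f) p = dot (G p) m.
  rewrite deriveB; [|exact/diff_derivable/differentiable_enorm
                   |exact/diff_derivable/df].
  by rewrite derive_enorm// (derive_grad _ (df p0)) -dotBl.
have G0 : 0 < dot (G p) (G p).
  by rewrite lt_def dot_eq0 level_gradient_neq0// dot_ge0.
have mn : 0 < dot m n.
  rewrite lt_def; apply/andP; split.
    apply/eqP => mn0; move: m1; rewrite mG mn0 scale0r => /eqP.
    by rewrite /enorm dot0l sqrtr0 eq_sym oner_eq0.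
  by move: F0; rewrite DE {1}mG dotZr pmulr_lge0.
by rewrite -[m]direction_sphere// [in LHS]mG directionZ.
Unshelve. all: by end_near. Qed.

Lemma sphere_graphE n : sphere 1 n -> X n - c = r n *: n.
Proof. by move=> n1; rewrite /X addrAC subrr add0r. Qed.

(* Both sides agree on the interface, so they have the same derivative after
   composition with the radial projection [y |-> radial X (y - c)] onto it. *)
Lemma tangential_derive_normal n w : sphere 1 n -> dot (G (r n *: n)) w = 0 ->
  'D_w nu (X n) = 'D_w (@direction R \o G) (r n *: n).
Proof.
move=> n1 Gw; have [p0 pe pd pf] := radial_scale_sphere n1.
have Xp : radial X (r n *: n) = X n by rewrite /radial pd.
have Dw : 'D_w (radial X) (r n *: n) = w.
  by rewrite derive_radial_graph// Gw scale0r subr0.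
have dX := differentiable_radial_graph p0.
have dnu : differentiable nu (X n).
  have [[U [_ SU sU]] _] := nuP.
  by have := sU [::] (X n); apply; apply: SU; exists n.
have dGp : differentiable (@direction R \o G) (r n *: n).
  apply: (differentiable_comp (differentiable_level_gradient p0)).
  exact/differentiable_direction/level_gradient_neq0.
pose sh := fun y : 'rV[R]_3 => y - c.
have dsh y : differentiable sh y.
  by apply: differentiableB => //; exact: differentiable_cst.
have Dsh y v : 'D_v sh y = v.
  rewrite /sh deriveB; [|exact: derivable_id|exact: derivable_cst].
  by rewrite derive_id derive_cst subr0.
have shX : sh (X n) = r n *: n by exact: sphere_graphE.
have dG' : differentiable (@direction R \o G) (sh (X n)) by rewrite shX.
have dGX : differentiable ((@direction R \o G) \o sh) (radial X (r n *: n)).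
  by rewrite Xp; exact: (differentiable_comp (dsh _) dG').
have dnuX : differentiable nu (radial X (r n *: n)) by rewrite Xp.
transitivity ('D_w (nu \o radial X) (r n *: n)).
  by rewrite (derive_comp _ dX dnuX) Dw Xp.
transitivity ('D_w (((@direction R \o G) \o sh) \o radial X) (r n *: n)); last first.
  by rewrite (derive_comp _ dX dGX) Dw Xp (derive_comp _ (dsh _) dG') Dsh shX.
apply: near_eq_derive; near=> y.
have y0 : y != 0 by near: y; exact: near_neq0.
have y1 := sphere_direction y0.
rewrite -[LHS]/(nu (X (direction y))) (outer_unit_normalE y1).
by rewrite -[RHS]/(direction (G (X (direction y) - c))) (sphere_graphE y1).
Unshelve. all: by end_near. Qed.

(** For a unit [N] the directions on the right are the basis vectors projected to the tangent plane.
    This form brings the surface divergence within reach of [tangential_derive_normal]. *)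
Lemma surf_divE (N F : 'rV[R]_3 -> 'rV[R]_3) y : differentiable F y ->
  surf_div N F y =
    \sum_(i < 3) 'D_(ebase R i - N y 0 i *: N y) F y 0 i.
Proof.
move=> dF; apply: eq_bigr => i _; have dFi := differentiable_coordE i dF.
rewrite /surf_grad !mxE -derive_grad// -derive_coord; last exact: diff_derivable.
by rewrite !derive_grad// dotBr dotZr mulrC.
Qed.

(* The mean curvature is the divergence of [G / |G|], and
   [|G|^2 = 1 + |grad f|^2] because [grad f] is orthogonal to the rays. *)
Lemma curvature_radial_graph n : sphere 1 n ->
  surf_div nu nu (X n) =
    (enorm (G (r n *: n)))^-1 * (2 / r n - divergence (grad f) (r n *: n))
    - (enorm (G (r n *: n)))^-1 ^+ 3 *
      dot (grad f (r n *: n)) ('D_(G (r n *: n)) (grad f) (r n *: n)).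
Proof.
move=> n1; have [p0 pe pd pf] := radial_scale_sphere n1.
have dnu : differentiable nu (X n).
  have [[U [_ SU sU]] _] := nuP.
  by have := sU [::] (X n); apply; apply: SU; exists n.
have nuE := outer_unit_normalE n1.
set p := r n *: n in p0 pe pd pf nuE *.
have G0 : G p != 0 by exact: level_gradient_neq0.
have e0 : enorm (G p) != 0 by rewrite enorm_eq0.
have dG := differentiable_level_gradient p0.
have dd := differentiable_direction G0.
have dGp := differentiable_comp dG dd.
have Dd w : 'D_w (@direction R \o G) p =
    (enorm (G p))^-1 *: 'D_w G p
      - ((enorm (G p))^-1 ^+ 3 * dot (grad f p) ('D_w (grad f) p)) *: G p.
  rewrite (derive_comp _ dG dd) (derive_direction _ G0).
  by rewrite (dot_derive_level_gradient _ p0).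
have DdN w : dot ('D_w (@direction R \o G) p) (G p) = 0.
  rewrite Dd dotBl !dotZl -(dot_derive_level_gradient _ p0) -enorm2.
  by rewrite (dotC _ (G p)); field.
rewrite (surf_divE _ dnu) nuE.
(* A unit field is orthogonal to its own derivatives ([DdN]), so the normal parts removed from the
   basis vectors contribute nothing and the full divergence remains. *)
transitivity (\sum_(i < 3) 'D_(ebase R i) (@direction R \o G) p 0 i).
  pose m := direction (G p).
  have E i : 'D_(ebase R i - m 0 i *: m) nu (X n) 0 i =
      'D_(ebase R i) (@direction R \o G) p 0 i - m 0 i * 'D_m (@direction R \o G) p 0 i.
    rewrite (tangential_derive_normal n1); last first.
      rewrite dotBr dotZr dot_ebaser /m /direction dotZr -enorm2 coordZ.
      by field.
    by rewrite (deriveE _ dGp) linearB linearZ -!(deriveE _ dGp) coordB coordZ.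
  rewrite (eq_bigr _ (fun i _ => E i)) sumrB.
  have -> : \sum_(i < 3) m 0 i * 'D_m (@direction R \o G) p 0 i = 0.
    by rewrite -[LHS]/(dot m _) dotC {2}/m /direction dotZr DdN mulr0.
  by rewrite subr0.
rewrite (eq_bigr (fun i => (enorm (G p))^-1 * 'D_(ebase R i) G p 0 i
   - (enorm (G p))^-1 ^+ 3 *
     (G p 0 i * dot (grad f p) ('D_(ebase R i) (grad f) p)))); last first.
  by move=> i _; rewrite Dd coordB !coordZ; ring.
rewrite sumrB -!mulr_sumr; congr (_ * _ - _ * _).
  transitivity (\sum_(i < 3) ('D_(ebase R i) (@direction R) p 0 i
     - 'D_(ebase R i) (fun y => grad f y 0 i) p)).
    apply: eq_bigr => i _; rewrite (_ : G = @direction R - grad f)//.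
    rewrite deriveB; [|exact/diff_derivable/differentiable_direction
                      |exact/diff_derivable/ddf].
    by rewrite [in RHS]derive_coord ?mxE//; exact/diff_derivable/ddf.
  rewrite sumrB; congr (_ - _).
  (* The divergence of [direction] at [p] is [3 / r n - enorm p ^+ 2 / r n ^+ 3], that is
     [2 / r n]. *)
  rewrite (eq_bigr (fun i => (enorm p)^-1 - (enorm p)^-1 ^+ 3 * (p 0 i * p 0 i))).
    rewrite sumrB -mulr_sumr -[X in _ * X]/(dot p p) -enorm2 pe sumr_const.
    by rewrite card_ord; field; rewrite gt_eqF ?r0.
  move=> i _; rewrite (derive_direction _ p0) coordB !coordZ dot_ebaser.
  by rewrite ebase_diag /p !coordZ; ring.
(* Linearity of the derivative in its direction collects the double sum into one derivative along
   [G p]. *)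
rewrite (derive_sumE (G p) (ddf p0)) /dot.
rewrite [RHS](eq_bigr (fun j => \sum_(i < 3)
   grad f p 0 j * (G p 0 i * 'D_(ebase R i) (grad f) p 0 j))); last first.
  move=> j _; rewrite summxE mulr_sumr; apply: eq_bigr => i _.
  by rewrite coordZ.
rewrite exchange_big; apply: eq_bigr => i _; rewrite mulr_sumr.
by apply: eq_bigr => j _; ring.
Qed.

End RadialGraph.

(** * The Laplace-Beltrami operator on functions constant along rays *)

(** Explicit formulas for gradients of radial functions hold only off the origin. The differential
    of [f] serves for [g], because the two first-order expansions agree near [x]. *)
Lemma near_eq_differentiable (R : realType) (V W : normedModType R)
    (f g : V -> W) (x : V) :
  (\forall y \near x, f y = g y) -> differentiable f x -> differentiable g x.
Proof.
move=> fg df; have fgx : f x = g x := nbhs_singleton fg.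
have gE : g \o shift x = cst (g x) + 'd f x +o_ (0 : V) id.
  apply/eqaddoP => e e0; have /eqaddoP/(_ e e0) := diff_locally df.
  have fg0 : \forall y \near (0 : V), f (y + x) = g (y + x).
    rewrite (near_shift x) /=; near=> y; rewrite /= sub0r subrK.
    by near: y.
  apply: filterS2 fg0 => y fgy.
  by rewrite /= -[(f \o shift x - _) y]/(f (y + x) - (f x + 'd f x y)) fgy fgx.
have cf := @diff_continuous _ _ _ _ _ df.
by apply/diff_locallyP; rewrite (diff_unique cf gE); split; [exact: cf|exact: gE].
Unshelve. all: by end_near. Qed.

Section Laplacian.
Context {R : realType}.
Implicit Types (x y w : 'rV[R]_3) (F G : 'rV[R]_3 -> 'rV[R]_3).

Lemma divergenceE F x : differentiable F x ->
  divergence F x = \sum_(i < 3) 'D_(ebase R i) F x 0 i.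
Proof.
move=> dF; apply: eq_bigr => i _; apply: derive_coord.
exact: diff_derivable.
Qed.

Lemma near_eq_divergence F G x : (\forall y \near x, F y = G y) ->
  divergence F x = divergence G x.
Proof.
move=> FG; apply: eq_bigr => i _; apply: near_eq_derive; near=> y.
by have -> : F y = G y by near: y.
Unshelve. all: by end_near. Qed.

Lemma near_eq_surf_div (N : 'rV[R]_3 -> 'rV[R]_3) F G x :
  (\forall y \near x, F y = G y) -> surf_div N F x = surf_div N G x.
Proof.
move=> FG; apply: eq_bigr => i _; rewrite /surf_grad.
have -> // : grad (fun y => F y 0 i) x = grad (fun y => G y 0 i) x.
apply/rowP => j; rewrite !mxE; apply: near_eq_derive.
by near=> y; have -> : F y = G y by near: y.
Unshelve. all: by end_near. Qed.

Lemma divergenceD F G x : differentiable F x -> differentiable G x ->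
  divergence (F + G) x = divergence F x + divergence G x.
Proof.
move=> dF dG; rewrite (divergenceE dF) (divergenceE dG).
rewrite (divergenceE (differentiableD dF dG)) -big_split; apply: eq_bigr => i _.
rewrite deriveD; [|exact: diff_derivable..].
by rewrite mxE.
Qed.

(** The gradient of a radial function is already tangential to the spheres, so [surf_grad] is [grad]
    near [x]. The normal term of the divergence vanishes by differentiating [dot (grad f y) y = 0]
    along [n = direction x]: the other summand, [dot (grad f x) n], is zero as well. *)
Lemma laplace_beltrami_radial (g : 'rV[R]_3 -> R) x :
  (forall y, y != 0 -> differentiable (radial g) y) ->
  (forall y, y != 0 -> differentiable (grad (radial g)) y) -> x != 0 ->
  laplace_beltrami (@direction R) (radial g) x = divergence (grad (radial g)) x.
Proof.
move=> dg ddg x0; set f := radial g in dg ddg *.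
have f_dir y : y != 0 -> dot (grad f y) (direction y) = 0.
  by move=> y0; rewrite /direction dotZr (grad_radial_dot dg y0) mulr0.
transitivity (surf_div (@direction R) (grad f) x).
  apply: near_eq_surf_div; near=> y; rewrite /surf_grad f_dir ?scale0r ?subr0//.
  by near: y; exact: near_neq0.
have df := ddg _ x0.
rewrite (surf_divE _ df) (divergenceE df).
set n := direction x.
have E i : 'D_(ebase R i - n 0 i *: n) (grad f) x 0 i =
    'D_(ebase R i) (grad f) x 0 i - n 0 i * 'D_n (grad f) x 0 i.
  by rewrite (deriveE _ df) linearB linearZ -!(deriveE _ df) coordB coordZ.
rewrite [LHS](eq_bigr _ (fun i _ => E i)) sumrB.
have -> : \sum_(i < 3) n 0 i * 'D_n (grad f) x 0 i = 0.
  rewrite -[LHS]/(dot n _) dotC {2}/n /direction dotZr.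
  have <- : 'D_n (fun y => dot (grad f y) y) x = dot ('D_n (grad f) x) x.
    rewrite derive_dot; [|exact: diff_derivable|exact: derivable_id].
    by rewrite derive_id f_dir// addr0.
  have -> : 'D_n (fun y => dot (grad f y) y) x = 0; last by rewrite mulr0.
  rewrite -(derive_cst (0 : R) x n); apply: near_eq_derive; near=> y.
  apply: (grad_radial_dot dg).
  by near: y; exact: near_neq0.
by rewrite subr0.
Unshelve. all: by end_near. Qed.

Variable a : 'rV[R]_3.
Let l : 'rV[R]_3 -> R := radial (dot a).
Let b := fun y => (@enorm R y)^-1.

Lemma differentiable_linear_harmonic y : y != 0 -> differentiable l y.
Proof.
move=> y0; apply: differentiable_dot; first exact: differentiable_cst.
exact: differentiable_direction.
Qed.

Lemma grad_linear_harmonic y : y != 0 ->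
  grad l y = b y *: a - (b y ^+ 3 * dot a y) *: y.
Proof.
move=> y0; apply: dot_inj => w.
rewrite -(derive_grad w (differentiable_linear_harmonic y0)).
rewrite derive_dot; last 2 first.
- exact: derivable_cst.
- exact/diff_derivable/differentiable_direction.
rewrite derive_cst dot0l add0r derive_direction// dotBr dotBl !dotZr !dotZl.
by rewrite /b mulrAC.
Qed.

(** The coordinates of [grad l] as sums and products of functions, the shape to which the derivation
    rules apply. *)
Let gl i := b * cst (a 0 i) - (b * b * b * dot a) * (fun y : 'rV[R]_3 => y 0 i).

Let glE i y : y != 0 -> grad l y 0 i = gl i y.
Proof.
move=> y0; rewrite (grad_linear_harmonic y0) coordB !coordZ.
rewrite -[RHS]/(b y * a 0 i - (b y * b y * b y * dot a y) * y 0 i).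
by ring.
Qed.

Let db y : y != 0 -> differentiable b y.
Proof. exact: differentiable_enormV. Qed.

Let ddot y : differentiable (dot a) y.
Proof. exact: (@differentiable_dot _ _ (cst a) id). Qed.

Let dgl i y : y != 0 -> differentiable (gl i) y.
Proof.
move=> y0; apply: differentiableB.
  by apply: differentiableM; [exact: db|exact: differentiable_cst].
apply: differentiableM; last exact: differentiable_coord.
apply: differentiableM; last exact: ddot.
apply: differentiableM; last exact: db.
by apply: differentiableM; exact: db.
Qed.

Lemma differentiable_grad_linear_harmonic y : y != 0 -> differentiable (grad l) y.
Proof.
move=> y0; apply: differentiable_rV => i.
apply: (near_eq_differentiable _ (dgl i y0)); near=> z.
by rewrite glE//; near: z; exact: near_neq0.
Unshelve. all: by end_near. Qed.

(** The eigenvalue [- k (k + 1)] of the spherical Laplacian at degree [k = 1]. In the sum of second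
    derivatives, the coefficients of [b y ^+ 3 * dot a y] are [3], [-2] and [-3]. *)
Lemma laplacian_linear_harmonic y : y != 0 ->
  divergence (grad l) y = - 2 * (b y ^+ 2) * l y.
Proof.
move=> y0; have e0 : enorm y != 0 by rewrite enorm_eq0.
have D i : 'D_(ebase R i) (fun z => grad l z 0 i) y =
    (3 * b y ^+ 5 * dot a y) * (y 0 i * y 0 i) - 2 * b y ^+ 3 * (a 0 i * y 0 i)
    - b y ^+ 3 * dot a y.
  rewrite (_ : 'D_(ebase R i) _ y = 'D_(ebase R i) (gl i) y); last first.
    apply: near_eq_derive; near=> z.
    by rewrite glE//; near: z; exact: near_neq0.
  have dd v : derivable (dot a) y v by exact/diff_derivable/ddot.
  have dbb v : derivable b y v by exact/diff_derivable/db.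
  have db2 v := derivableM (dbb v) (dbb v).
  have db3 v := derivableM (db2 v) (dbb v).
  have db3d v := derivableM (db3 v) (dd v).
  have dc v : derivable (fun z : 'rV[R]_3 => z 0 i) y v.
    exact/diff_derivable/differentiable_coord.
  have dcst v : derivable (cst (a 0 i) : 'rV[R]_3 -> R) y v by exact: derivable_cst.
  have did v : derivable (id : 'rV[R]_3 -> 'rV[R]_3) y v by exact: derivable_id.
  have dca v : derivable (cst a : 'rV[R]_3 -> 'rV[R]_3) y v.
    exact: derivable_cst.
  have Dd v : 'D_v (dot a) y = dot a v.
    by rewrite (derive_dot (dca v) (did v)) derive_cst dot0l add0r derive_id.
  have Dc v : 'D_v (fun z : 'rV[R]_3 => z 0 i) y = v 0 i.
    by rewrite (derive_coord i (did v)) derive_id.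
  rewrite /gl (deriveB (derivableM (dbb _) (dcst _)) (derivableM (db3d _) (dc _))).
  rewrite (deriveM (dbb _) (dcst _)) (deriveM (db3d _) (dc _)).
  rewrite (deriveM (db3 _) (dd _)) (deriveM (db2 _) (dbb _)).
  rewrite (deriveM (dbb _) (dbb _)) derive_cst Dd.
  rewrite Dc ebase_diag.
  rewrite (derive_enormV _ y0) !dot_ebaser /GRing.scale /= -!/(b y).
  rewrite -[(b * b * b) y]/(b y * b y * b y) -[(b * b) y]/(b y * b y).
  rewrite -[(b * b * b * dot a) y]/(b y * b y * b y * dot a y).
  by ring.
rewrite /divergence (eq_bigr _ (fun i _ => D i)) !sumrB -!mulr_sumr.
rewrite -/(dot y y) -/(dot a y) -enorm2 sumr_const card_ord.
by rewrite /l /radial /direction dotZr /b; field.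
Unshelve. all: by end_near. Qed.

End Laplacian.

(** * First-order expansions *)

Section RightLimits.
Context {R : realType}.

Lemma cvg_id_at_right : e @[e --> (0 : R)^'+] --> (0 : R).
Proof. by apply: cvg_at_right_filter; exact: cvg_id. Qed.

Lemma cvg_quotient_at_right (W : normedModType R) (g : R -> W) (k : W) (C : R) :
  (\forall e \near 0^'+, `|g e - e *: k| <= C * e ^+ 2) ->
  e^-1 *: g e @[e --> 0^'+] --> k.
Proof.
move=> gk; apply/cvgrPdist_le => d d0; near=> e.
have e0 : 0 < e by near: e; exact: nbhs_right_gt.
have -> : k - e^-1 *: g e = - (e^-1 *: (g e - e *: k)).
  by rewrite scalerBr scalerA mulVf ?gt_eqF// scale1r opprB.
rewrite normrN normrZ gtr0_norm ?invr_gt0// ler_pdivrMl//.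
apply: (@le_trans _ _ (C * e ^+ 2)); first by near: e.
rewrite expr2 mulrCA ler_pM2l//.
have Ce : C * e <= `|C| * e by rewrite ler_wpM2r ?ler_norm ?ltW.
(* The bound [C] may be zero or negative; [|C| + 1] is a positive substitute. *)
have : e <= d / (`|C| + 1).
  by near: e; apply: nbhs_right_le; rewrite divr_gt0// ltr_wpDl.
rewrite ler_pdivlMr ?ltr_wpDl// mulrDr mulr1 [e * _]mulrC => ed.
lra.
Unshelve. all: by end_near. Qed.

Lemma cvg0_of_quotient (W : normedModType R) (g : R -> W) (k : W) :
  e^-1 *: g e @[e --> 0^'+] --> k -> g e @[e --> 0^'+] --> (0 : W).
Proof.
move=> gk.
have lim : e *: (e^-1 *: g e) @[e --> 0^'+] --> 0 *: k.
  by apply: cvgZ; [exact: cvg_id_at_right|exact: gk].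
rewrite scale0r in lim; apply: cvg_trans lim; apply: near_eq_cvg; near=> e.
have e0 : 0 < e by near: e; exact: nbhs_right_gt.
by rewrite scalerA divff ?gt_eqF// scale1r.
Unshelve. all: by end_near. Qed.

Lemma cvg_coord {T : Type} {F : set_system T} {FF : Filter F}
    (g : T -> 'rV[R]_3) (k : 'rV[R]_3) i :
  g s @[s --> F] --> k -> g s 0 i @[s --> F] --> k 0 i.
Proof. by move=> gk; exact: (cvg_comp _ _ gk (@coord_continuous _ _ _ _ _ _)). Qed.

Lemma cvg_dot {T : Type} {F : set_system T} {FF : Filter F}
    (g1 g2 : T -> 'rV[R]_3) (k1 k2 : 'rV[R]_3) :
  g1 s @[s --> F] --> k1 -> g2 s @[s --> F] --> k2 ->
  dot (g1 s) (g2 s) @[s --> F] --> dot k1 k2.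
Proof.
move=> gk1 gk2; rewrite dotE; under eq_fun do rewrite dotE.
by do ![apply: cvgD]; apply: cvgM; exact: cvg_coord.
Qed.

(** The device by which coefficients of [e] are equated: an equation divided by [e] holds for small
    [e], and both sides have known limits. *)
Lemma cvg_at_right_unique (W : normedModType R) (g1 g2 : R -> W) (k1 k2 : W) :
  g1 e @[e --> 0^'+] --> k1 -> g2 e @[e --> 0^'+] --> k2 ->
  (\forall e \near 0^'+, g1 e = g2 e) -> k1 = k2.
Proof.
move=> gk1 gk2 g12; apply: (cvg_unique _ gk1) => //.
apply: cvg_trans gk2; apply: near_eq_cvg; near=> e; symmetry.
by near: e.
Unshelve. all: by end_near. Qed.

End RightLimits.

Section Expansion.
Context {R : realType} {W : normedModType R} (D : set (R * 'rV[R]_3))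
  (f : R -> R -> 'rV[R]_3 -> W) (f0 : W) (f1 : R -> 'rV[R]_3 -> W).
Hypothesis (fE : expansion D f f0 f1).

Lemma expansion_differentiable z : D z ->
  \forall e \near 0^'+, differentiable (spacetime (f e)) z.
Proof.
move=> Dz; have [_ fs _] := fE; near=> e.
have fse : smooth_on D (spacetime (f e)) by near: e.
exact: (fse [::] z Dz).
Unshelve. all: by end_near. Qed.

(** The evaluation point may move with [e], as interface points do: the remainder bound holds on a
    whole neighbourhood of [z], and [f1] is continuous at [z]. *)
Lemma expansion_cvg z (y : R -> R * 'rV[R]_3) : D z ->
  y e @[e --> 0^'+] --> z ->
  e^-1 *: (spacetime (f e) (y e) - f0) @[e --> 0^'+] --> spacetime f1 z.
Proof.
move=> Dz yz; have [f1s _ fr] := fE.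
have [C [[A1 A2]/= [FA1 zA2] A12]] := fr [::] z Dz.
have f1c : spacetime f1 (y e) @[e --> 0^'+] --> spacetime f1 z.
  apply: (cvg_comp _ _ yz).
  exact: (differentiable_continuous (f1s [::] z Dz)).
have r0 : e^-1 *: (spacetime (f e) (y e) - f0 - e *: spacetime f1 (y e))
    @[e --> 0^'+] --> (0 : W).
  apply: (@cvg_quotient_at_right _ _ _ _ C); near=> e.
  have A1e : A1 e by near: e.
  have A2e : A2 (y e) by near: e; exact: yz.
  have := A12 (e, y e) (conj A1e A2e).
  by rewrite /= scaler0 subr0 /spacetime opprD addrA.
rewrite -[spacetime f1 z]add0r; apply: cvg_trans (cvgD r0 f1c).
apply: near_eq_cvg; near=> e.
have e0 : 0 < e by near: e; exact: nbhs_right_gt.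
rewrite -[LHS]/(_ *: _ + _) scalerBr scalerA mulVf ?gt_eqF// scale1r.
by rewrite subrK.
Unshelve. all: by end_near. Qed.

Lemma expansion_cvg_at z : D z ->
  e^-1 *: (spacetime (f e) z - f0) @[e --> 0^'+] --> spacetime f1 z.
Proof. by move=> Dz; apply: (@expansion_cvg z (cst z)) => //; exact: cvg_cst. Qed.

Lemma expansion_derive_cvg z w : D z ->
  e^-1 *: 'D_w (spacetime (f e)) z @[e --> 0^'+] --> 'D_w (spacetime f1) z.
Proof.
move=> Dz; have [f1s _ fr] := fE.
have [C [[A1 A2]/= [FA1 zA2] A12]] := fr [:: w] z Dz.
apply: (@cvg_quotient_at_right _ _ _ _ C); near=> e.
have A1e : A1 e by near: e.
have := A12 (e, z) (conj A1e (nbhs_singleton zA2)).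
have df : derivable (spacetime (f e)) z w.
  by apply: diff_derivable; near: e; exact: expansion_differentiable.
have df1 : derivable (spacetime f1) z w.
  by apply: diff_derivable; exact: (f1s [::] z Dz).
have dZ := derivableZ (k := e) df1.
rewrite /= (_ : spacetime _ = spacetime (f e) - (cst f0 + e *: spacetime f1)) //.
have dc : derivable (cst f0) z w by exact: derivable_cst.
rewrite (deriveB df (derivableD dc dZ)) (deriveD dc dZ) derive_cst add0r.
by rewrite (deriveZ _ df1).
Unshelve. all: by end_near. Qed.

Lemma expansion_limit_differentiable z : D z -> differentiable (spacetime f1) z.
Proof. by move=> Dz; have [f1s _ _] := fE; exact: (f1s [::] z Dz). Qed.

Lemma expansion_cvg0 z : D z ->
  spacetime (f e) z - f0 @[e --> 0^'+] --> (0 : W).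
Proof.
by move=> Dz; exact: (cvg0_of_quotient (expansion_cvg_at Dz)).
Qed.

Lemma expansion_dt_cvg t x : D (t, x) ->
  e^-1 *: dt (f e) t x @[e --> 0^'+] --> dt f1 t x.
Proof.
move=> Dz; rewrite dt_slice; under eq_fun do rewrite dt_slice.
exact: expansion_derive_cvg.
Qed.

Lemma expansion_slice_derive_cvg t x w : D (t, x) ->
  e^-1 *: 'D_w (f e t) x @[e --> 0^'+] --> 'D_w (f1 t) x.
Proof.
move=> Dz; rewrite derive_slice; under eq_fun do rewrite derive_slice.
exact: expansion_derive_cvg.
Qed.

End Expansion.

(** * Limits of the bulk equations at a fixed point *)

Section BulkLimit.
Context {R : realType} (Dr Dv Dp : set (R * 'rV[R]_3)).
Context (rho : R -> R -> 'rV[R]_3 -> R) (v : R -> R -> 'rV[R]_3 -> 'rV[R]_3)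
  (P : R -> R -> 'rV[R]_3 -> R) (rho0 p0 : R)
  (rho1 p1 : R -> 'rV[R]_3 -> R) (u : R -> 'rV[R]_3 -> 'rV[R]_3).
Hypotheses (rhoE : expansion Dr rho rho0 rho1) (vE : expansion Dv v 0 u)
  (PE : expansion Dp P p0 p1).
Variables (t : R) (x : 'rV[R]_3).
Hypotheses (rz : Dr (t, x)) (vz : Dv (t, x)) (pz : Dp (t, x)).

Let v_cvg : e^-1 *: v e t x @[e --> 0^'+] --> u t x.
Proof.
have := expansion_cvg_at vE vz.
by under eq_fun do rewrite subr0.
Qed.

Let rho_cvg : rho e t x @[e --> 0^'+] --> rho0.
Proof.
rewrite -[rho0]add0r; apply: cvg_trans (cvgD (expansion_cvg0 rhoE rz) (cvg_cst rho0)).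
by apply: near_eq_cvg; near=> e; rewrite -[LHS]/(rho e t x - rho0 + rho0) subrK.
Unshelve. all: by end_near. Qed.

Lemma continuity_equation_limit :
  (\forall e \near 0^'+,
     dt (rho e) t x + divergence (fun y => rho e t y *: v e t y) x = 0) ->
  dt rho1 t x + rho0 * divergence (u t) x = 0.
Proof.
move=> eqn.
have du : differentiable (u t) x.
  exact/differentiable_slice/(expansion_limit_differentiable vE).
(* The [i]-th term of the divergence divided by [e], after the product rule. The derivative of [rho]
   is itself of order [e], so only the second summand survives. *)
pose S e i := 'D_(ebase R i) (rho e t) x * (e^-1 *: v e t x) 0 i
   + rho e t x * (e^-1 *: 'D_(ebase R i) (v e t) x) 0 i.
have Sc i : S e i @[e --> 0^'+] --> rho0 * 'D_(ebase R i) (u t) x 0 i.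
  have c1 : 'D_(ebase R i) (rho e t) x @[e --> 0^'+] --> (0 : R).
    have H := expansion_slice_derive_cvg rhoE (w := ebase R i) rz.
    exact: (cvg0_of_quotient H).
  have c2 := cvg_coord (i := i) v_cvg.
  have c4 := cvg_coord (i := i) (expansion_slice_derive_cvg vE (w := ebase R i) vz).
  have lim : S e i @[e --> 0^'+] -->
      0 * u t x 0 i + rho0 * 'D_(ebase R i) (u t) x 0 i.
    by apply: cvgD; apply: cvgM; [exact: c1|exact: c2|exact: rho_cvg|exact: c4].
  by rewrite mul0r add0r in lim; exact: lim.
have lim : e^-1 * dt (rho e) t x + (S e 0 + S e 1 + S e 2%:R) @[e --> 0^'+] -->
    dt rho1 t x + rho0 * divergence (u t) x.
  rewrite (divergenceE du) sum3E !mulrDr.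
  apply: cvgD; first exact: (expansion_dt_cvg rhoE).
  by do ![apply: cvgD].
apply: (cvg_at_right_unique lim (cvg_cst 0)); near=> e.
have e0 : e != 0 by rewrite gt_eqF//; near: e; exact: nbhs_right_gt.
have dr : differentiable (rho e t) x.
  by apply: differentiable_slice; near: e; exact: (expansion_differentiable rhoE).
have dv : differentiable (v e t) x.
  by apply: differentiable_slice; near: e; exact: (expansion_differentiable vE).
have : dt (rho e) t x + divergence (fun y => rho e t y *: v e t y) x = 0.
  by near: e.
rewrite -sum3E => eqne.
rewrite (_ : \sum_(i < 3) S e i
   = e^-1 * divergence (fun y => rho e t y *: v e t y) x); last first.
  rewrite /divergence mulr_sumr; apply: eq_bigr => i _.
  have dvi : derivable (fun y => v e t y 0 i) x (ebase R i).
    exact/diff_derivable/differentiable_coordE.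
  have dri : derivable (rho e t) x (ebase R i) by exact/diff_derivable.
  rewrite (_ : (fun y => _) = rho e t * (fun y => v e t y 0 i)); last first.
    by apply/funext => y; rewrite coordZ.
  rewrite (deriveM dri dvi) (derive_coord i (diff_derivable dv)) /S !coordZ.
  rewrite /GRing.scale /=.
  by ring.
by rewrite -mulrDr eqne mulr0.
Unshelve. all: by end_near. Qed.

Lemma momentum_equation_limit :
  (\forall e \near 0^'+,
     rho e t x *: (dt (v e) t x + advection (v e t) x) + grad (P e t) x = 0) ->
  rho0 *: dt u t x + grad (p1 t) x = 0.
Proof.
move=> eqn; apply/rowP => j.
have -> : (rho0 *: dt u t x + grad (p1 t) x) 0 j =
    (rho0 *: dt u t x) 0 j + 'D_(ebase R j) (p1 t) x.
  by rewrite mxE; congr (_ + _); rewrite mxE.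
rewrite coordZ mxE.
(* The advection term is quadratic in the velocity: after division by [e], one factor [v] still
   tends to zero. *)
pose S e i := v e t x 0 i * (e^-1 *: 'D_(ebase R i) (v e t) x) 0 j.
have Sc i : S e i @[e --> 0^'+] --> (0 : R).
  have v0 : v e t x @[e --> 0^'+] --> (0 : 'rV[R]_3) := cvg0_of_quotient v_cvg.
  have c1 := cvg_coord (i := i) v0.
  have c2 := cvg_coord (i := j) (expansion_slice_derive_cvg vE (w := ebase R i) vz).
  have lim : S e i @[e --> 0^'+] -->
      (0 : 'rV[R]_3) 0 i * 'D_(ebase R i) (u t) x 0 j.
    by apply: cvgM; [exact: c1|exact: c2].
  by rewrite mxE mul0r in lim; exact: lim.
have lim : rho e t x * ((e^-1 *: dt (v e) t x) 0 j + (S e 0 + S e 1 + S e 2%:R))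
    + e^-1 * 'D_(ebase R j) (P e t) x @[e --> 0^'+] -->
    rho0 * dt u t x 0 j + 'D_(ebase R j) (p1 t) x.
  have -> : dt u t x 0 j = dt u t x 0 j + (0 + 0 + 0) by rewrite !addr0.
  apply: cvgD; last exact: (expansion_slice_derive_cvg PE).
  apply: cvgM; first exact: rho_cvg.
  apply: cvgD; first by apply: cvg_coord; exact: (expansion_dt_cvg vE).
  by do ![apply: cvgD].
apply: (cvg_at_right_unique lim (cvg_cst 0)); near=> e.
have : rho e t x *: (dt (v e) t x + advection (v e t) x) + grad (P e t) x = 0.
  by near: e.
move=> /rowP/(_ j); rewrite mxE coordZ [X in _ * X]mxE [X in _ + X]mxE [RHS]mxE.
rewrite /advection summxE -sum3E => eqne.
rewrite (_ : \sum_(i < 3) S e i = e^-1 *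
    \sum_(i < 3) (v e t x 0 i *: 'D_(ebase R i) (v e t) x) 0 j); last first.
  by rewrite mulr_sumr; apply: eq_bigr => i _; rewrite /S !coordZ; ring.
by rewrite coordZ -mulrDr mulrCA -mulrDr eqne mulr0.
Unshelve. all: by end_near. Qed.

(** A chain rule at [e = 0] carried out on difference quotients, since [rho e t x] is controlled
    only through its first-order expansion and may equal [rho0] for arbitrarily small [e]. *)
Lemma pressure_law_limit (p : R -> R) : p0 = p rho0 -> differentiable p rho0 ->
  (\forall e \near 0^'+, P e t x = p (rho e t x)) ->
  p1 t x = 'D_1 p rho0 * rho1 t x.
Proof.
move=> p0E dp eqn.
(* [q] is the difference quotient, extended continuously to [h = 0]. *)
pose q h := if h == 0 then 'D_1 p rho0 else h^-1 * (p (h + rho0) - p rho0).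
have q0 : q h @[h --> (0 : R)] --> 'D_1 p rho0.
  have -> : 'D_1 p rho0 = q 0 by rewrite /q eqxx.
  apply/continuous_withinNx; rewrite {2}/q eqxx.
  have dp1 : derivable p rho0 1 by exact: diff_derivable.
  apply: cvg_trans dp1; apply: near_eq_cvg; near=> h.
  have h0 : h != 0 by near: h; exact: nbhs_dnbhs_neq.
  by rewrite /q (negbTE h0) /= /GRing.scale /= mulr1.
have lim : q (rho e t x - rho0) * (e^-1 * (rho e t x - rho0)) @[e --> 0^'+] -->
    'D_1 p rho0 * rho1 t x.
  apply: cvgM; last exact: (expansion_cvg_at rhoE rz).
  exact: (cvg_comp _ _ (expansion_cvg0 rhoE rz) q0).
apply: (cvg_at_right_unique (expansion_cvg_at PE pz) lim).
near=> e; rewrite /spacetime /=.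
have -> : P e t x = p (rho e t x) by near: e.
rewrite mulrCA p0E /GRing.scale /=; congr (_ * _).
rewrite /q; case: eqVneq => [/eqP|d0].
  by rewrite subr_eq0 => /eqP ->; rewrite !subrr mulr0.
by rewrite mulrAC mulVf// mul1r subrK.
Unshelve. all: by end_near. Qed.

End BulkLimit.

(** * The perturbed bubble *)

Section Spheres.
Context {R : realType}.
Implicit Types (x y : 'rV[R]_3) (r : R).

Lemma continuous_enorm : continuous (@enorm R).
Proof.
move=> x; apply: (@continuous_comp _ _ _ (fun y => dot y y) Num.sqrt).
  exact/differentiable_continuous/differentiable_dot.
exact: sqrt_continuous.
Qed.

Lemma continuous_direction x : x != 0 -> {for x, continuous (@direction R)}.
Proof. by move=> x0; exact/differentiable_continuous/differentiable_direction. Qed.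

Lemma norm_le_enorm x : `|x| <= enorm x.
Proof.
rewrite [leLHS]/Num.Def.normr /= mx_normrE; apply/bigmax_leP; split=> [|[i j] _ /=].
  exact: enorm_ge0.
rewrite ord1 -ler_sqr ?nnegrE ?enorm_ge0// enorm2 real_normK ?num_real//.
rewrite /dot (bigD1 j)//= expr2 lerDl.
by apply: sumr_ge0 => k _; rewrite -expr2 sqr_ge0.
Qed.

Lemma compact_sphere r : compact (@sphere R r).
Proof.
apply: bounded_closed_compact.
  exists r; split; first exact: num_real.
  by move=> M rM x xr; apply: le_trans (ltW rM); rewrite -xr norm_le_enorm.
apply: (@preimage_closed _ _ _ [set r]).
- by move=> x _; exact: continuous_enorm.
- exact: closed_eq.
Qed.

Lemma closed_ball_closed r : closed [set x : 'rV[R]_3 | enorm x <= r].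
Proof.
apply: (@preimage_closed _ _ _ [set s | s <= r]).
- by move=> x _; exact: continuous_enorm.
- exact: closed_le.
Qed.

Lemma closure_open_ball_sub r : closure (@open_ball R r) `<=` [set x | enorm x <= r].
Proof.
apply: (@subset_trans _ (closure [set x : 'rV[R]_3 | enorm x <= r])).
  by apply: closureS => x /ltW.
by rewrite -(closure_id _).1//; exact: closed_ball_closed.
Qed.

(** Used with [a = -1] and [a = 1] to reach a point of a sphere from inside and from outside. *)
Lemma cvg_dilation x (a : R) : (1 + s * a) *: x @[s --> 0^'+] --> x.
Proof.
have E : x = (1 + 0 * a) *: x by rewrite mul0r addr0 scale1r.
rewrite [X in _ --> X]E; apply: cvgZl; apply: cvgD; first exact: cvg_cst.
by apply: cvgM; [exact: cvg_id_at_right|exact: cvg_cst].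
Qed.

Lemma sphere_sub_closure_open_ball r x : 0 < r -> sphere r x ->
  closure (open_ball r) x.
Proof.
move=> r0 xr A xA; have nA := @cvg_dilation x (-1) A xA.
near ((0 : R)^'+) => s.
exists ((1 + s * -1) *: x); split; last by near: s.
have s0 : 0 < s by near: s; exact: nbhs_right_gt.
have s1 : s < 1 by near: s; apply: nbhs_right_lt.
rewrite /open_ball /= enormZ xr ger0_norm; last by rewrite mulrN1 subr_ge0 ltW.
by rewrite mulrN1 gtr_pMl// ltrBlDr ltrDl.
Unshelve. all: by end_near. Qed.

Lemma sphere_sub_closure_region r a x : 0 < r -> sphere r x ->
  closure (region (open_ball r) a) x.
Proof.
case: a => r0 xr; last exact: sphere_sub_closure_open_ball.
move=> A xA; have nA := @cvg_dilation x 1 A xA.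
near ((0 : R)^'+) => s.
exists ((1 + s * 1) *: x); split; last by near: s.
have s0 : 0 < s by near: s; exact: nbhs_right_gt.
move=> /closure_open_ball_sub; rewrite /= enormZ xr mulr1 gtr0_norm ?addr_gt0//.
by apply/negP; rewrite -ltNge ltr_pMl// ltrDl.
Unshelve. all: by end_near. Qed.

Lemma region_liquid_enorm r x : 0 < r -> region (open_ball r) liquid x ->
  r < enorm x.
Proof.
move=> r0 xr; rewrite ltNge; apply/negP; rewrite le_eqVlt => /predU1P[xr'|xr'].
  by apply: xr; exact: sphere_sub_closure_open_ball.
by apply: xr; exact: subset_closure.
Qed.

(** Compactness of the sphere. A bound uniform in [n] is called for because the direction from the
    moving centre [e *: xi] to a fixed point changes with [e]. *)
Lemma radial_bounded (h : 'rV[R]_3 -> R) :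
  (forall y, y != 0 -> differentiable (radial h) y) ->
  exists2 M, 0 < M & forall n, sphere 1 n -> `|h n| <= M.
Proof.
move=> dh.
have hc : {within sphere 1, continuous (radial h)}.
  apply: continuous_in_subspaceT => n; rewrite inE => n1.
  exact/differentiable_continuous/dh/sphere1_neq0.
have [M [_ hM]] := compact_bounded (continuous_compact hc (@compact_sphere 1)).
exists (`|M| + 1); first by rewrite ltr_wpDl.
move=> n n1; apply: hM; first by rewrite (le_lt_trans (ler_norm M))// ltrDl.
by exists n => //; rewrite /radial direction_sphere.
Qed.

Lemma eventually_radius_gt0 (h : 'rV[R]_3 -> R) (R0 : R) : 0 < R0 ->
  (forall y, y != 0 -> differentiable (radial h) y) ->
  \forall e \near 0^'+, forall m, sphere 1 m -> 0 < R0 + e * h m.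
Proof.
move=> R00 dh; have [M M0 hM] := radial_bounded dh; near=> e => m m1.
have e0 : 0 < e by near: e; exact: nbhs_right_gt.
have : e < R0 / M by near: e; apply: nbhs_right_lt; exact: divr_gt0.
rewrite ltr_pdivlMr// => eM.
have := hM m m1; rewrite ler_norml => /andP[+ _].
by rewrite -(ler_pM2l e0); lra.
Unshelve. all: by end_near. Qed.

(** The radius stays between [R0 - e * M] and [R0 + e * M], while the distance from [x] to the
    centre tends to [enorm x], which is strictly on one side of [R0]. *)
Lemma eventually_region (B : R -> set 'rV[R]_3) (R0 : R) (xi : 'rV[R]_3)
    (h : 'rV[R]_3 -> R) a x : 0 < R0 ->
  (forall y, y != 0 -> differentiable (radial h) y) ->
  (\forall e \near 0^'+, [/\ open (B e), bounded_set (B e)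
     & frontier (B e) = (fun n => e *: xi + (R0 + e * h n) *: n) @` sphere 1]) ->
  region (open_ball R0) a x -> \forall e \near 0^'+, region (B e) a x.
Proof.
move=> R00 dh BE xR; have [M M0 hM] := radial_bounded dh.
have eM : R0 + e * M @[e --> (0 : R)^'+] --> R0.
  have E : R0 = R0 + 0 * M by rewrite mul0r addr0.
  rewrite [X in _ --> X]E; apply: cvgD; first exact: cvg_cst.
  by apply: cvgM; [exact: cvg_id_at_right|exact: cvg_cst].
have eMN : R0 - e * M @[e --> (0 : R)^'+] --> R0.
  have E : R0 = R0 - 0 * M by rewrite mul0r subr0.
  rewrite [X in _ --> X]E; apply: cvgB; first exact: cvg_cst.
  by apply: cvgM; [exact: cvg_id_at_right|exact: cvg_cst].
have xe : enorm (x - e *: xi) @[e --> (0 : R)^'+] --> enorm x.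
  have xx : x - e *: xi @[e --> (0 : R)^'+] --> x - 0 *: xi.
    by apply: cvgB; [exact: cvg_cst|apply: cvgZl; exact: cvg_id_at_right].
  rewrite scale0r subr0 in xx.
  exact: (cvg_comp _ _ xx (@continuous_enorm x)).
have hMe e m : 0 < e -> sphere 1 m -> R0 - e * M <= R0 + e * h m <= R0 + e * M.
  move=> e0 /hM; rewrite ler_norml => /andP[h1 h2].
  by rewrite -mulrN !lerD2l !ler_pM2l// h1 h2.
have pos := eventually_radius_gt0 R00 dh.
have c0 (y c : 'rV[R]_3) : y != c -> sphere 1 (direction (y - c)).
  by rewrite -subr_eq0; exact: sphere_direction.
case: a xR => [/(region_liquid_enorm R00)|] xR; near=> e.
- have [oB bB fB] : [/\ open (B e), bounded_set (B e)
     & frontier (B e) = (fun n => e *: xi + (R0 + e * h n) *: n) @` sphere 1].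
    by near: e.
  have e0 : 0 < e by near: e; exact: nbhs_right_gt.
  have re : forall m, sphere 1 m -> 0 < R0 + e * h m by near: e.
  have : 0 < enorm (x - e *: xi) - (R0 + e * M).
    near: e; apply: (@cvgr_gt _ _ _ _ _ (enorm x - R0)); last by rewrite subr_gt0.
    by apply: cvgB.
  rewrite subr_gt0 => xM.
  have xc : x != e *: xi.
    apply: contraTneq xM => ->; rewrite subrr /enorm dot0l sqrtr0 -leNgt.
    by rewrite addr_ge0 ?mulr_ge0 ?ltW.
  suff : ~ closure (B e) x by [].
  apply: (bubble_outside oB bB fB re xc); apply: le_lt_trans xM.
  by have /andP[] := hMe e _ e0 (c0 _ _ xc).
- have [oB bB fB] : [/\ open (B e), bounded_set (B e)
     & frontier (B e) = (fun n => e *: xi + (R0 + e * h n) *: n) @` sphere 1].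
    by near: e.
  have e0 : 0 < e by near: e; exact: nbhs_right_gt.
  have re : forall m, sphere 1 m -> 0 < R0 + e * h m by near: e.
  have : 0 < (R0 - e * M) - enorm (x - e *: xi).
    near: e; apply: (@cvgr_gt _ _ _ _ _ (R0 - enorm x)); last by rewrite subr_gt0.
    by apply: cvgB.
  rewrite subr_gt0 => xM.
  (* The centre has no unit direction, so the uniform bound on [h] says nothing there. *)
  have [->|xc] := eqVneq x (e *: xi); first exact: (center_in_bubble oB bB fB re).
  apply: (bubble_inside oB bB fB re); apply: lt_le_trans xM _.
  by have /andP[] := hMe e _ e0 (c0 _ _ xc).
Unshelve. all: by end_near. Qed.

End Spheres.

(** * Spatial regularity at a fixed time *)

Section SmoothSlice.
Context {R : realType} (f : R -> 'rV[R]_3 -> R) (t : R).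
Hypotheses (t0 : 0 < t)
  (fs : smooth_on [set z : R * 'rV[R]_3 | 0 < z.1 /\ z.2 != 0] (spacetime f)).

Let uncurryK (W : Type) (K : R * 'rV[R]_3 -> W) :
  spacetime (fun s y => K (s, y)) = K.
Proof. by apply/funext => -[]. Qed.

Lemma smooth_slice_derive y w :
  'D_w (f t) y = iter_derive [:: (0, w)] (spacetime f) (t, y).
Proof. exact: derive_slice. Qed.

Lemma smooth_slice_grad y i :
  grad (f t) y 0 i = iter_derive [:: (0, ebase R i)] (spacetime f) (t, y).
Proof. by rewrite mxE smooth_slice_derive. Qed.

Let diff_iter vs y : y != 0 ->
  differentiable (fun y => iter_derive vs (spacetime f) (t, y)) y.
Proof.
move=> y0.
apply: (@differentiable_slice _ _ _ (fun s y => iter_derive vs (spacetime f) (s, y))).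
by rewrite uncurryK; apply: fs; split.
Qed.

Lemma smooth_slice_differentiable y : y != 0 -> differentiable (f t) y.
Proof. exact: (@diff_iter [::]). Qed.

Lemma smooth_slice_differentiable_grad y : y != 0 -> differentiable (grad (f t)) y.
Proof.
move=> y0; apply: differentiable_rV => i.
rewrite (_ : (fun z => _) =
  fun z => iter_derive [:: (0, ebase R i)] (spacetime f) (t, z)).
  exact: diff_iter.
by apply/funext => z; exact: smooth_slice_grad.
Qed.

(** Supplies the continuity of second derivatives needed to pass to the limit in the curvature at a
    moving point. *)
Lemma smooth_slice_differentiable_hessian w y : y != 0 ->
  differentiable (fun z => 'D_w (grad (f t)) z) y.
Proof.
move=> y0; apply: differentiable_rV => i.
apply: near_eq_differentiable
  (@diff_iter [:: (0, ebase R i); (0, w)] y y0); near=> z.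
have dg : derivable (grad (f t)) z w.
  apply/diff_derivable/smooth_slice_differentiable_grad.
  by near: z; exact: near_neq0.
rewrite -(derive_coord i dg) /= -[in LHS](uncurryK ('D__ _)) -derive_slice.
by congr ('D_w _ z); apply/funext => z'; rewrite smooth_slice_grad.
Unshelve. all: by end_near. Qed.

End SmoothSlice.

(** * Linearized normal and curvature *)

Section InterfaceLimit.
Context {R : realType} (R0 : R) (h : 'rV[R]_3 -> R) (n : 'rV[R]_3).
Let g := radial h.
Hypotheses (R00 : 0 < R0) (n1 : sphere 1 n)
  (dg : forall y, y != 0 -> differentiable g y)
  (ddg : forall y, y != 0 -> differentiable (grad g) y)
  (dddg : forall w y, y != 0 -> differentiable (fun z => 'D_w (grad g) z) y).

Let r (e : R) := fun m => R0 + e * h m.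
Let p (e : R) := r e n *: n.
Let G (e : R) := level_gradient (radial (r e)) (p e).

Lemma perturbed_differentiable e y : y != 0 -> differentiable (radial (r e)) y.
Proof.
move=> y0; apply: (@differentiableD _ _ _ (cst R0) (e *: g)).
  exact: differentiable_cst.
exact/differentiableZ/dg.
Qed.

Lemma perturbed_derive e y w : y != 0 -> 'D_w (radial (r e)) y = e * 'D_w g y.
Proof.
move=> y0; have dgw : derivable g y w by exact/diff_derivable/dg.
have dc : derivable (cst R0) y w by exact: derivable_cst.
have dz := derivableZ (k := e) dgw.
rewrite -[radial (r e)]/(cst R0 + e *: g) (deriveD dc dz) derive_cst add0r.
by rewrite (deriveZ _ dgw).
Qed.

Lemma perturbed_grad e y : y != 0 -> grad (radial (r e)) y = e *: grad g y.
Proof.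
by move=> y0; apply/rowP => i; rewrite coordZ !mxE perturbed_derive.
Qed.

Let near_perturbed_grad e (y : 'rV[R]_3) : y != 0 ->
  \forall z \near y, (e *: grad g) z = grad (radial (r e)) z.
Proof.
move=> y0; near=> z; rewrite perturbed_grad//.
by near: z; exact: near_neq0.
Unshelve. all: by end_near. Qed.

Lemma perturbed_differentiable_grad e y : y != 0 ->
  differentiable (grad (radial (r e))) y.
Proof.
move=> y0; apply: (near_eq_differentiable (near_perturbed_grad e y0)).
exact/differentiableZ/ddg.
Qed.

Lemma perturbed_derive_grad e y w : y != 0 ->
  'D_w (grad (radial (r e))) y = e *: 'D_w (grad g) y.
Proof.
move=> y0; rewrite -(near_eq_derive w (near_perturbed_grad e y0)).
by rewrite deriveZ//; exact/diff_derivable/ddg.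
Qed.

Lemma perturbed_divergence_grad e y : y != 0 ->
  divergence (grad (radial (r e))) y = e * divergence (grad g) y.
Proof.
move=> y0; rewrite (divergenceE (perturbed_differentiable_grad e y0)).
rewrite (divergenceE (ddg y0)) mulr_sumr; apply: eq_bigr => i _.
by rewrite perturbed_derive_grad// coordZ.
Qed.

Lemma perturbed_radius_cvg : r e n @[e --> 0^'+] --> R0.
Proof.
have E : R0 = R0 + 0 * h n by rewrite mul0r addr0.
rewrite [X in _ --> X]E; apply: cvgD; first exact: cvg_cst.
by apply: cvgM; [exact: cvg_id_at_right|exact: cvg_cst].
Qed.

Lemma perturbed_radius_gt0 : \forall e \near 0^'+, 0 < r e n.
Proof. exact: (cvgr_gt _ perturbed_radius_cvg). Qed.

Let x := R0 *: n.
Let x0 : x != 0.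
Proof. by rewrite scaler_eq0 negb_or gt_eqF//= sphere1_neq0. Qed.

Let p_cvg : p e @[e --> 0^'+] --> x.
Proof. by apply: cvgZl; exact: perturbed_radius_cvg. Qed.

Let cvg_at_p (W : normedModType R) (k : 'rV[R]_3 -> W) :
  differentiable k x -> k (p e) @[e --> 0^'+] --> k x.
Proof. by move=> dk; exact: (cvg_comp _ _ p_cvg (differentiable_continuous dk)). Qed.

Let p0 e : 0 < r e n -> p e != 0.
Proof. by move=> re; rewrite scaler_eq0 negb_or gt_eqF//= sphere1_neq0. Qed.

Let GE e : 0 < r e n -> G e = n - e *: grad g (p e).
Proof.
move=> re; rewrite /G /level_gradient (perturbed_grad _ (p0 re)).
by rewrite /p directionZ// direction_sphere.
Qed.

Lemma normal_cvg : G e @[e --> 0^'+] --> n.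
Proof.
have lim : n - e *: grad g (p e) @[e --> 0^'+] --> n - 0 *: grad g x.
  apply: cvgB; first exact: cvg_cst.
  by apply: cvgZ; [exact: cvg_id_at_right|exact: cvg_at_p (ddg x0)].
rewrite scale0r subr0 in lim; apply: cvg_trans lim; apply: near_eq_cvg.
by near=> e; rewrite GE//; near: e; exact: perturbed_radius_gt0.
Unshelve. all: by end_near. Qed.

Lemma unit_normal_cvg : direction (G e) @[e --> 0^'+] --> n.
Proof.
rewrite -[X in _ --> X](direction_sphere n1).
exact: (cvg_comp _ _ normal_cvg (continuous_direction (sphere1_neq0 n1))).
Qed.

Let enormG_cvg : enorm (G e) @[e --> 0^'+] --> (1 : R).
Proof.
rewrite -[X in _ --> X]n1.
exact: (cvg_comp _ _ normal_cvg (@continuous_enorm _ n)).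
Qed.

(** The last term of the curvature formula without its factor [e ^+ 2], which comes from the two
    gradients [e *: grad g]. *)
Let T e := dot (grad g (p e)) ('D_(G e) (grad g) (p e)).

Let T_cvg : T e @[e --> 0^'+] --> dot (grad g x) ('D_n (grad g) x).
Proof.
(* Both the point and the direction of this derivative vary with [e]; expanding along the basis
   leaves derivatives in fixed directions, continuous by [dddg]. *)
pose S e := G e 0 0 *: 'D_(ebase R 0) (grad g) (p e)
  + G e 0 1 *: 'D_(ebase R 1) (grad g) (p e)
  + G e 0 2%:R *: 'D_(ebase R 2%:R) (grad g) (p e).
have lim : dot (grad g (p e)) (S e) @[e --> 0^'+] -->
    dot (grad g x) ('D_n (grad g) x).
  rewrite (derive_sumE n (ddg x0)) sum3E.
  apply: cvg_dot; first exact: cvg_at_p (ddg x0).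
  have cH i : G e 0 i *: 'D_(ebase R i) (grad g) (p e) @[e --> 0^'+] -->
      n 0 i *: 'D_(ebase R i) (grad g) x.
    by apply: cvgZ; [exact: cvg_coord normal_cvg|exact: cvg_at_p (dddg _ x0)].
  by apply: cvgD; [apply: cvgD|]; exact: cH.
apply: cvg_trans lim; apply: near_eq_cvg; near=> e.
have pe0 : p e != 0 by apply: p0; near: e; exact: perturbed_radius_gt0.
by rewrite /T (derive_sumE (G e) (ddg pe0)) sum3E.
Unshelve. all: by end_near. Qed.

(** Three exact identities remove the division by [e]: [2 / r e n - 2 / R0] equals
    [- 2 e h n / (R0 r e n)]; with [N = enorm (G e)], [1 / N - 1] equals [- e^2 q e / (N (1 + N))];
    and the Hessian term is [e^2 T e / N^3]. After division by [e] the last two still carry a factor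
    [e] and vanish in the limit. *)
Lemma curvature_cvg :
  e^-1 * ((enorm (G e))^-1 * (2 / r e n - divergence (grad (radial (r e))) (p e))
    - (enorm (G e))^-1 ^+ 3 *
      dot (grad (radial (r e)) (p e)) ('D_(G e) (grad (radial (r e))) (p e))
    - 2 / R0) @[e --> 0^'+] -->
  - (2 / R0 ^+ 2 * h n + divergence (grad g) x).
Proof.
pose L y := divergence (grad g) y.
pose q e := dot (grad g (p e)) (grad g (p e)).
have L_cvg : L (p e) @[e --> 0^'+] --> L x.
  have lim : 'D_(ebase R 0) (grad g) (p e) 0 0
     + 'D_(ebase R 1) (grad g) (p e) 0 1
     + 'D_(ebase R 2%:R) (grad g) (p e) 0 2%:R @[e --> 0^'+] --> L x.
    rewrite /L (divergenceE (ddg x0)) sum3E.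
    by do ![apply: cvgD]; apply: cvg_coord; exact: cvg_at_p (dddg _ x0).
  apply: cvg_trans lim; apply: near_eq_cvg; near=> e.
  have pe0 : p e != 0 by apply: p0; near: e; exact: perturbed_radius_gt0.
  by rewrite /L (divergenceE (ddg pe0)) sum3E.
have q_cvg : q e @[e --> 0^'+] --> q 0.
  have p00 : p 0 = x by rewrite /p /r mul0r addr0.
  by rewrite /q p00; apply: cvg_dot; exact: cvg_at_p (ddg x0).
have Gi : (enorm (G e))^-1 @[e --> 0^'+] --> (1 : R)^-1.
  by apply: cvgV enormG_cvg; exact: oner_neq0.
have ri : (r e n)^-1 @[e --> 0^'+] --> R0^-1.
  by apply: cvgV perturbed_radius_cvg; rewrite gt_eqF.
have G1i : (1 + enorm (G e))^-1 @[e --> 0^'+] --> (1 + 1 : R)^-1.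
  apply: cvgV; first by rewrite -[1 + 1]/(2%:R) pnatr_eq0.
  by apply: cvgD; [exact: cvg_cst|exact: enormG_cvg].
have lim : (enorm (G e))^-1 * (- (2 * h n * R0^-1) * (r e n)^-1 - L (p e))
   - 2 / R0 * (e * (q e * ((enorm (G e))^-1 * (1 + enorm (G e))^-1)))
   - e * ((enorm (G e))^-1 * (enorm (G e))^-1 * (enorm (G e))^-1 * T e)
   @[e --> 0^'+] -->
   1^-1 * (- (2 * h n * R0^-1) * R0^-1 - L x)
   - 2 / R0 * (0 * (q 0 * (1^-1 * (1 + 1)^-1)))
   - 0 * (1^-1 * 1^-1 * 1^-1 * dot (grad g x) ('D_n (grad g) x)).
  apply: cvgB.
    apply: cvgB.
      apply: cvgM Gi _; apply: cvgB L_cvg.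
      by apply: cvgM ri; exact: cvg_cst.
    apply: cvgM; first exact: cvg_cst.
    apply: cvgM; first exact: cvg_id_at_right.
    by apply: cvgM q_cvg _; apply: cvgM Gi G1i.
  apply: cvgM; first exact: cvg_id_at_right.
  by do ![apply: cvgM => //].
have -> : - (2 / R0 ^+ 2 * h n + divergence (grad g) x) =
   1^-1 * (- (2 * h n * R0^-1) * R0^-1 - L x)
   - 2 / R0 * (0 * (q 0 * (1^-1 * (1 + 1)^-1)))
   - 0 * (1^-1 * 1^-1 * 1^-1 * dot (grad g x) ('D_n (grad g) x)).
  by rewrite -/(L x) !mul0r mulr0 invr1; field; rewrite gt_eqF.
apply: cvg_trans lim; apply: near_eq_cvg; near=> e.
have e0 : e != 0 by rewrite gt_eqF//; near: e; exact: nbhs_right_gt.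
have re : 0 < r e n by near: e; exact: perturbed_radius_gt0.
have Gp : 0 < enorm (G e) by near: e; apply: (cvgr_gt _ enormG_cvg).
have pe0 := p0 re.
(* The identity for the squared length of [G], solved for [q e], turns the remaining goal into a
   rational identity in [enorm (G e)]. *)
have qE : q e = (enorm (G e) ^+ 2 - 1) / e ^+ 2.
  have := dot_level_gradient_self (@perturbed_differentiable e) pe0.
  rewrite -/(G e) -enorm2 (perturbed_grad _ pe0) dotZl dotZr -/(q e) => ->.
  by field.
rewrite (perturbed_grad _ pe0) (perturbed_derive_grad _ _ pe0) dotZl dotZr -/(T e).
rewrite (perturbed_divergence_grad _ pe0) -/(L (p e)) qE.
have := gt_eqF re; rewrite /r => /negbT re0.
have G10 : 1 + enorm (G e) != 0 by rewrite gt_eqF ?addr_gt0.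
field.
by rewrite re0 e0 G10 !gt_eqF.
Unshelve. all: by end_near. Qed.

End InterfaceLimit.

(** * Velocity of the perturbed interface *)

Section TimeDerivative.
Context {R : realType} (xi : R -> 'rV[R]_3) (k : R -> R) (t : R) (n : 'rV[R]_3).
Hypotheses (dxi : derivable xi t 1) (dk : derivable k t 1).

(** The parametrization is affine in [e], so its velocity is exactly a multiple of [e], without
    remainder. *)
Lemma derive_perturbed_graph (R0 e : R) :
  'D_1 (fun s => e *: xi s + (R0 + e * k s) *: n) t =
    e *: ('D_1 xi t + 'D_1 k t *: n).
Proof.
have dkd : differentiable k t by exact/derivable1_diffP.
have dkn : differentiable (fun s => k s *: n) t by exact: differentiableZl.
have dkn1 : derivable (fun s => k s *: n) t 1 by exact: diff_derivable.
have Dkn : 'D_1 (fun s => k s *: n) t = 'D_1 k t *: n.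
  by rewrite (deriveE _ dkn) (deriveE _ dkd) diffZl.
have dx := derivableD dxi dkn1.
have dz := derivableZ (k := e) dx.
have dc : derivable (cst (R0 *: n)) t (1 : R) by exact: derivable_cst.
rewrite (_ : (fun s => _) = e *: (xi + (fun s => k s *: n)) + cst (R0 *: n)).
  by rewrite (deriveD dz dc) (deriveZ _ dx) (deriveD dxi dkn1) derive_cst addr0 Dkn.
apply/funext => s; rewrite -[RHS]/(e *: (xi s + k s *: n) + R0 *: n).
by rewrite scalerDl scalerDr scalerA -[RHS]addrA; congr (_ + _); exact: addrC.
Qed.

Lemma derive_dot_add :
  'D_1 (fun s => dot (xi s) n + k s) t = dot ('D_1 xi t) n + 'D_1 k t.
Proof.
have dc : derivable (cst n) t (1 : R) by exact: derivable_cst.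
have dd : derivable (fun s => dot (xi s) n) t 1.
  apply/diff_derivable/differentiable_dot; last exact: differentiable_cst.
  exact: ((derivable1_diffP _ _).1 dxi).
rewrite (deriveD dd dk); congr (_ + _).
by rewrite (derive_dot dxi dc) derive_cst dotC [X in _ + X]dotC dot0l addr0 dotC.
Qed.

End TimeDerivative.

Theorem proposition2p2 (R : realType) (sigma R0 : R)
    (rho0 : phase -> R) (Plaw : phase -> R -> R)
    (B : R -> R -> set 'rV[R]_3)
    (nu : R -> R -> 'rV[R]_3 -> 'rV[R]_3)
    (rho : phase -> R -> R -> 'rV[R]_3 -> R)
    (v : phase -> R -> R -> 'rV[R]_3 -> 'rV[R]_3)
    (P : phase -> R -> R -> 'rV[R]_3 -> R)
    (u : phase -> R -> 'rV[R]_3 -> 'rV[R]_3)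
    (rho1 p1 : phase -> R -> 'rV[R]_3 -> R)
    (xi : R -> 'rV[R]_3) (h : R -> 'rV[R]_3 -> R)
    (D : phase -> set (R * 'rV[R]_3)) :
  let p0 := fun a => Plaw a (rho0 a) in
  let K := fun a => rho0 a * 'D_1 (Plaw a) (rho0 a) in
  let X := fun (e t : R) (n : 'rV[R]_3) => e *: xi t + (R0 + e * h t n) *: n in
  let eta := fun (t : R) (n : 'rV[R]_3) => dot (xi t) n + h t n in
  0 < sigma -> 0 < R0 -> (forall a, 0 < rho0 a) ->
  (forall a, smooth_on [set r : R | 0 < r] (Plaw a)) ->
  (forall a, 'D_1 (Plaw a) (rho0 a) != 0) ->
  p0 gas - p0 liquid = 2 * sigma / R0 ->
  smooth_on [set t : R | 0 < t] xi ->
  smooth_on [set z : R * 'rV[R]_3 | 0 < z.1 /\ z.2 != 0]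
    (spacetime (fun t => radial (h t))) ->
  (forall t : R, 0 < t -> orthogonal_to_degree_one (h t)) ->
  (\forall e \near 0^'+,
     two_phase_euler sigma Plaw (B e) (X e) (nu e)
       (fun a => rho a e) (fun a => v a e) (fun a => P a e)) ->
  (forall a, open (D a) /\
     closed_region (fun _ => open_ball R0) a `<=` D a) ->
  (forall a, expansion (D a) (v a) 0 (u a)) ->
  (forall a, expansion (D a) (rho a) (rho0 a) (rho1 a)) ->
  (forall a, expansion (D a) (P a) (p0 a) (p1 a)) ->
  (forall a (t : R) x, 0 < t -> region (open_ball R0) a x ->
     rho0 a *: dt (u a) t x + grad (p1 a t) x = 0 /\
     (K a)^-1 * dt (p1 a) t x + divergence (u a t) x = 0) /\
  (forall (t : R) x, 0 < t -> sphere R0 x ->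
     let n := R0^-1 *: x in
     [/\ dt eta t n = dot (u liquid t x) n,
         dot (u liquid t x) n = dot (u gas t x) n
       & p1 liquid t x - p1 gas t x =
         sigma * (laplace_beltrami (@direction R) (radial (eta t)) x
                  + 2 / R0 ^+ 2 * eta t n)]).
Proof.
move=> p0 K X eta sigma0 R00 rho00 Ps Pd0 p0E xis hs _ sys Dp vE rhoE PE.
have gs t : 0 < t -> forall y, y != 0 -> differentiable (radial (h t)) y.
  by move=> t0 y y0; exact: (smooth_slice_differentiable t0 hs y0).
have graph t : 0 < t -> \forall e \near 0^'+, [/\ open (B e t), bounded_set (B e t)
     & frontier (B e t) = X e t @` sphere 1].
  move=> t0; near=> e.
  have S : two_phase_euler sigma Plaw (B e) (X e) (nu e)
    (fun a => rho a e) (fun a => v a e) (fun a => P a e) by near: e.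
  split; [exact: (bubble_open S)|exact: (bubble_bounded S)|].
  exact: (bubble_frontier S).
have regB a t x : 0 < t -> region (open_ball R0) a x ->
    \forall e \near 0^'+, region (B e t) a x.
  by move=> t0; exact: (eventually_region R00 (gs t t0) (graph t t0)).
have regD a t x : 0 < t -> region (open_ball R0) a x -> D a (t, x).
  by move=> t0 xR; apply: (Dp a).2; split => //; exact: subset_closure.
have bulkB a t x : 0 < t -> region (open_ball R0) a x -> \forall e \near 0^'+,
    [/\ dt (rho a e) t x + divergence (fun y => rho a e t y *: v a e t y) x = 0,
        rho a e t x *: (dt (v a e) t x + advection (v a e t) x)
          + grad (P a e t) x = 0
      & P a e t x = Plaw a (rho a e t x)].
  move=> t0 xR; near=> e.
  have S : two_phase_euler sigma Plaw (B e) (X e) (nu e)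
    (fun a => rho a e) (fun a => v a e) (fun a => P a e) by near: e.
  by apply: (bulk S) => //; near: e; exact: regB.
split.
  move=> a t x t0 xR; have Dz := regD a t x t0 xR; split.
    apply: (momentum_equation_limit (rhoE a) (vE a) (PE a) Dz Dz Dz).
    by apply: filterS (bulkB a t x t0 xR) => e [].
  have cont : dt (rho1 a) t x + rho0 a * divergence (u a t) x = 0.
    apply: (continuity_equation_limit (rhoE a) (vE a) Dz Dz).
    by apply: filterS (bulkB a t x t0 xR) => e [].
  (* Established at all positive times, since it is differentiated in time next. *)
  have pr s : 0 < s -> p1 a s x = 'D_1 (Plaw a) (rho0 a) * rho1 a s x.
    move=> s0; have Dsx := regD a s x s0 xR.
    apply: (pressure_law_limit (rhoE a) (PE a) Dsx Dsx) => //.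
      exact: (Ps a [::] (rho0 a) (rho00 a)).
    by apply: filterS (bulkB a s x s0 xR) => e [].
  have drho : derivable (fun s => rho1 a s x) t 1.
    exact/derivable_dt_slice/(expansion_limit_differentiable (rhoE a)).
  have dp1 : dt (p1 a) t x = 'D_1 (Plaw a) (rho0 a) * dt (rho1 a) t x.
    rewrite /dt -[RHS](deriveZ _ drho); apply: near_eq_derive; near=> s.
    rewrite pr//; near: s.
    by have tt : s @[s --> t] --> t by []; exact: (cvgr_gt _ tt).
  have r0 : rho0 a != 0 by rewrite gt_eqF.
  move: (Pd0 a) => c0; rewrite dp1 /K.
  apply: (mulfI r0); rewrite mulr0 -[RHS]cont; field.
  by rewrite c0 r0.
move=> t x t0 xS n.
have n1 : sphere 1 n.
  by rewrite /sphere /= enormZ xS gtr0_norm ?invr_gt0// mulVf ?gt_eqF.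
have xn : x = R0 *: n by rewrite /n scalerA divff ?scale1r ?gt_eqF.
(* Equilibrium interface points belong to the closure of both phases, hence to the open sets on
   which the two expansions hold. *)
have Dz a : D a (t, x).
  by apply: (Dp a).2; split => //; exact: sphere_sub_closure_region.
have hn s : radial (h s) n = h s n by rewrite /radial direction_sphere.
have dh : derivable (fun s => h s n) t 1.
  rewrite (_ : (fun s => _) = (fun s => radial (h s) n)).
    apply: (@derivable_dt_slice _ _ _ (fun s => radial (h s)) t n).
    by apply: (hs [::] (t, n)); split => //; exact: sphere1_neq0.
  by apply/funext => s; rewrite hn.
have dxi : derivable xi t 1 by apply: diff_derivable; exact: (xis [::] t t0).
have g1 := gs t t0.
have g2 y (y0 : y != 0) := smooth_slice_differentiable_grad t0 hs y0.
have g3 w y (y0 : y != 0) := smooth_slice_differentiable_hessian t0 hs w y0.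
have Xc : X e t n @[e --> 0^'+] --> x.
  have lim : X e t n @[e --> 0^'+] --> 0 *: xi t + R0 *: n.
    apply: cvgD; apply: cvgZl; first exact: cvg_id_at_right.
    exact: perturbed_radius_cvg.
  by rewrite scale0r add0r -xn in lim; exact: lim.
have tXc : (t, X e t n) @[e --> 0^'+] --> (t, x).
  by apply: (@cvg_pair _ _ _ _ (nbhs t) (nbhs x)); [exact: cvg_cst|exact: Xc].
pose r e m := R0 + e * h t m.
pose G e := level_gradient (radial (r e)) (r e n *: n).
have normals : \forall e \near 0^'+, nu e t (X e t n) = direction (G e) /\
    surf_div (nu e t) (nu e t) (X e t n) =
    (enorm (G e))^-1 * (2 / r e n - divergence (grad (radial (r e))) (r e n *: n))
    - (enorm (G e))^-1 ^+ 3 * dot (grad (radial (r e)) (r e n *: n))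
        ('D_(G e) (grad (radial (r e))) (r e n *: n)).
  have pos := eventually_radius_gt0 R00 g1.
  near=> e.
  have S : two_phase_euler sigma Plaw (B e) (X e) (nu e)
    (fun a => rho a e) (fun a => v a e) (fun a => P a e) by near: e.
  have re : forall m, sphere 1 m -> 0 < r e m by near: e.
  have dr := @perturbed_differentiable _ R0 _ g1 e.
  have ddr := @perturbed_differentiable_grad _ R0 _ g1 g2 e.
  have oB := bubble_open S t0; have bB := bubble_bounded S t0.
  have fB : frontier (B e t) = (fun m => e *: xi t + r e m *: m) @` sphere 1 :=
    bubble_frontier S t0.
  have nuP : is_outer_unit_normal (B e t) (fun m => e *: xi t + r e m *: m) (nu e t) :=
    nu_normal S t0.
  split; first exact: (outer_unit_normalE re dr oB bB fB nuP n1).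
  exact: (curvature_radial_graph re dr ddr oB bB fB nuP n1).
have nuc : nu e t (X e t n) @[e --> 0^'+] --> n.
  apply: cvg_trans (unit_normal_cvg R00 n1 g1 g2); apply: near_eq_cvg.
  by apply: filterS normals => e [-> _].
have kin a : dt eta t n = dot (u a t x) n.
  have vlim : dot (e^-1 *: v a e t (X e t n)) (nu e t (X e t n)) @[e --> 0^'+] -->
      dot (u a t x) n.
    apply: cvg_dot nuc; have := expansion_cvg (vE a) (Dz a) tXc.
    by under eq_fun do rewrite subr0.
  (* The interface velocity divided by [e]. It is constant in [e], and only the normal paired with
     it varies. *)
  pose w := 'D_1 xi t + 'D_1 (fun s => h s n) t *: n.
  have wlim : dot w (nu e t (X e t n)) @[e --> 0^'+] --> dot w n.
    by apply: cvg_dot nuc; exact: cvg_cst.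
  have -> : dt eta t n = dot w n.
    rewrite /dt /eta (derive_dot_add _ dxi dh) /w dotDl dotZl.
    by rewrite (sphere1_dot n1) mulr1.
  apply: (cvg_at_right_unique wlim vlim); near=> e.
  have e0 : e != 0 by rewrite gt_eqF//; near: e; exact: nbhs_right_gt.
  have S : two_phase_euler sigma Plaw (B e) (X e) (nu e)
    (fun a => rho a e) (fun a => v a e) (fun a => P a e) by near: e.
  have := kinematic S t0 n1 a.
  rewrite /dt (derive_perturbed_graph n dxi dh) -/w !dotZl => <-.
  by rewrite mulrA mulVf// mul1r.
split; [exact: kin|by rewrite -!kin|].
have plim a := expansion_cvg (PE a) (Dz a) tXc.
pose kappa e := surf_div (nu e t) (nu e t) (X e t n).
have klim : e^-1 * (kappa e - 2 / R0) @[e --> 0^'+] -->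
    - (2 / R0 ^+ 2 * h t n + divergence (grad (radial (h t))) x).
  rewrite xn; apply: cvg_trans (curvature_cvg R00 n1 g1 g2 g3).
  apply: near_eq_cvg; apply: filterS normals => e [_].
  by rewrite /kappa => ->.
have p1E : p1 gas t x - p1 liquid t x =
    sigma * - (2 / R0 ^+ 2 * h t n + divergence (grad (radial (h t))) x).
  have Llim : e^-1 * (P gas e t (X e t n) - p0 gas)
      - e^-1 * (P liquid e t (X e t n) - p0 liquid) @[e --> 0^'+] -->
      p1 gas t x - p1 liquid t x.
    by apply: cvgB; [exact: (plim gas)|exact: (plim liquid)].
  have Rlim : sigma * (e^-1 * (kappa e - 2 / R0)) @[e --> 0^'+] -->
      sigma * - (2 / R0 ^+ 2 * h t n + divergence (grad (radial (h t))) x).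
    by apply: cvgM; [exact: cvg_cst|exact: klim].
  apply: (cvg_at_right_unique Llim Rlim); near=> e.
  have S : two_phase_euler sigma Plaw (B e) (X e) (nu e)
    (fun a => rho a e) (fun a => v a e) (fun a => P a e) by near: e.
  have YL := young_laplace S t0 n1.
  (* The static balance [p0E] cancels the zeroth-order parts of the pressure jump and of
     [sigma * kappa e]. *)
  rewrite -mulrBr mulrCA; congr (_ * _).
  rewrite mulrBr -/(kappa e) -YL mulrA (mulrC sigma) -p0E; ring.
have x0 : x != 0 by rewrite -enorm_gt0 xS.
(* [radial (eta t)] is [l + radial (h t)], and the Laplacian of [l] at [x] is
   [- 2 / R0 ^+ 2 * dot (xi t) n], exactly offset by the share of [xi] in the term
   [2 / R0 ^+ 2 * eta t n]. *)
pose l := radial (dot (xi t)).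
have l1 y (y0 : y != 0) : differentiable l y := differentiable_linear_harmonic _ y0.
have l2 y (y0 : y != 0) : differentiable (grad l) y :=
  differentiable_grad_linear_harmonic _ y0.
have eta1 y : y != 0 -> differentiable (radial (eta t)) y.
  by move=> y0; exact: (differentiableD (l1 y y0) (g1 y y0)).
have grad_eta (y : 'rV[R]_3) : y != 0 ->
    (grad l + grad (radial (h t))) y = grad (radial (eta t)) y.
  move=> y0; apply/rowP => i.
  have d1 : derivable l y (ebase R i) by exact/diff_derivable/l1.
  have d2 : derivable (radial (h t)) y (ebase R i) by exact/diff_derivable/g1.
  rewrite mxE [X in X + _]mxE [X in _ + X]mxE [RHS]mxE.
  by rewrite -[radial (eta t)]/(l + radial (h t)) (deriveD d1 d2).
have grad_eta_near (y : 'rV[R]_3) : y != 0 -> \forall z \near y,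
    (grad l + grad (radial (h t))) z = grad (radial (eta t)) z.
  move=> y0; near=> z; apply: grad_eta.
  by near: z; exact: near_neq0.
have eta2 (y : 'rV[R]_3) : y != 0 -> differentiable (grad (radial (eta t))) y.
  move=> y0; apply: (near_eq_differentiable (grad_eta_near y y0)).
  exact: (differentiableD (l2 y y0) (g2 y y0)).
rewrite (laplace_beltrami_radial eta1 eta2 x0).
rewrite -(near_eq_divergence (grad_eta_near x x0)).
rewrite (divergenceD (l2 x x0) (g2 x x0)) (laplacian_linear_harmonic _ x0).
have -> : radial (dot (xi t)) x = dot (xi t) n.
  by rewrite /radial xn directionZ// direction_sphere.
rewrite xS -[LHS]opprB p1E /eta.
by field; rewrite gt_eqF.
Unshelve. all: by end_near. Qed.
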